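(* Let $G<\mathrm{Homeo}^+(\mathbf{R})$ be a coherent action of a finitely generated group for which there exists $x\in\mathbf{R}\cup\{\pm\infty\}$ such that a group of germs at $x$ (of the elements of $G$ that fix $x$) is either non-abelian, or abelian of rank greater than $1$. Then the underlying group $G$ does not embed into Thompson's group $F$.
   Context: $\mathrm{Homeo}^+(\mathbf{R})$ is the group of orientation preserving homeomorphisms of $\mathbf{R}$. Actions are right actions, $x\mapsto x\cdot g$. A group action $G<\mathrm{Homeo}^+(\mathbf{R})$ means a subgroup of $\mathrm{Homeo}^+(\mathbf{R})$. Groups of germs. For $x\in\mathbf{R}$, $G_x$ is the subgroup of elements fixing $x$; $G_x^+$ (resp. $G_x^-$) is the subgroup of $g\in G$ fixing pointwise $[x,x+\delta]$ (resp. $[x-\delta,x]$) for some $\delta>0$ depending on $g$. The groups of germs at $x$ are $G_x/G_x^+$ and $G_x/G_x^-$. At $+\infty$ (resp. $-\infty$) the only group of germs is the quotient of $G$ by the subgroup of elements with trivial germ at $+\infty$ (resp. $-\infty$), i.e. fixing each point of some $(r,\infty)$ (resp. $(-\infty,r)$). ''A group of germs at $x$'' means at least one of these groups. The rank of an abelian group $A$ is its torsion-free rank $\dim_{\mathbf{Q}}(A\otimes\mathbf{Q})$. The action $G<\mathrm{Homeo}^+(\mathbf{R})$ is coherent if: (i) it is minimal, i.e. all orbits are dense in $\mathbf{R}$; (ii) the groups of germs at $+\infty$ and at $-\infty$ are solvable; (iii) there exists an element of $G$ that has trivial germ at $-\infty$ and does not fix any point in some interval $(r,\infty)$; (iv)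 there exists an element of $G$ that has trivial germ at $+\infty$ and does not fix any point in some interval $(-\infty,s)$. Thompson's group $F$ is the group of orientation preserving piecewise linear homeomorphisms of $[0,1]$ with finitely many breakpoints, all dyadic rationals, and whose derivatives, wherever they exist, are powers of $2$. ''Embeds'' means: there is an injective group homomorphism. *)

(* Defs.v *)
From HB Require Import structures.
From mathcomp Require Import all_boot all_order all_algebra.
From mathcomp Require Import generic_quotient.
From mathcomp Require Import all_classical all_reals all_analysis.

Set Implicit Arguments.
Unset Strict Implicit.
Unset Printing Implicit Defensive.

Import Order.TTheory GRing.Theory Num.Theory.
Import numFieldNormedType.Exports.

Local Open Scope classical_set_scope.
Local Open Scope ring_scope.
Local Open Scope quotient_scope.

Section Subgroups.
Variables (gT : groupType) (S : groupClosed gT).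

Record subgroup : Type := Subgroup {
  subgroup_val :> gT;
  subgroup_valP : subgroup_val \in S
}.

HB.instance Definition _ := [isSub for subgroup_val].
HB.instance Definition _ := [Choice of subgroup by <:].

Fact subgroup_closed : group_closed [in S].
Proof. by split=> [|x y xS yS]; [exact: gpred1 | exact: gpredF]. Qed.

HB.instance Definition _ :=
  SubChoice_isSubGroup.Build gT [in S] subgroup subgroup_closed.

End Subgroups.

HB.mixin Record isNormalClosed (gT : groupType) (N : {pred gT}) := {
  gpredJr : {in N, forall x y : gT, (x ^ y)%g \in N}
}.

#[short(type="normalClosed")]
HB.structure Definition NormalClosed gT :=
  {N of isNormalClosed gT N & GroupClosed gT N}.

Section QuotientGroup.
Variables (gT : groupType) (N : normalClosed gT).
Local Open Scope group_scope.
Implicit Types x y z : gT.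

Definition same_coset : rel gT := fun x y => x / y \in N.

Fact same_coset_refl : reflexive same_coset.
Proof. by move=> x; rewrite /same_coset mulgV gpred1. Qed.

Fact same_coset_sym : symmetric same_coset.
Proof. by move=> x y; rewrite /same_coset gpredFC. Qed.

Fact same_coset_trans : transitive same_coset.
Proof.
move=> y x z xy yz; rewrite /same_coset.
by rewrite -(mulgVK y x) -mulgA gpredM.
Qed.

Canonical same_coset_equiv :=
  EquivRel same_coset same_coset_refl same_coset_sym same_coset_trans.

Definition quotient_group : Type := {eq_quot same_coset_equiv}.

HB.instance Definition _ := Choice.on quotient_group.
HB.instance Definition _ := EqQuotient.on quotient_group.

Definition quotient_one : quotient_group := \pi_quotient_group 1.
Definition quotient_mul (u v : quotient_group) : quotient_group :=
  \pi_quotient_group (repr u * repr v).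
Definition quotient_inv (u : quotient_group) : quotient_group :=
  \pi_quotient_group (repr u)^-1.

Fact quotient_eqP x y :
  reflect (\pi_quotient_group x = \pi_quotient_group y) (same_coset x y).
Proof. exact: (iffP (@eqquotP _ same_coset_equiv quotient_group x y)). Qed.

Fact quotient_repr x : same_coset (repr (\pi_quotient_group x)) x.
Proof. by apply/quotient_eqP; rewrite reprK. Qed.

Fact quotient_piM x y :
  quotient_mul (\pi_quotient_group x) (\pi_quotient_group y) =
  \pi_quotient_group (x * y).
Proof.
apply/quotient_eqP; have := quotient_repr x; have := quotient_repr y.
rewrite /same_coset; set y' := repr _; set x' := repr _ => yN xN.
have -> : x' * y' / (x * y) = (x' / x) * ((y' / y) ^ x^-1).
  by rewrite /conjg invgK invgM !mulgA mulgVK.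
by rewrite gpredM // gpredJr.
Qed.

Fact quotient_piV x :
  quotient_inv (\pi_quotient_group x) = \pi_quotient_group x^-1.
Proof.
apply/quotient_eqP; rewrite /same_coset invgK -gpredV invgM invgK.
have -> : x^-1 * repr (\pi_quotient_group x) =
          (repr (\pi_quotient_group x) / x) ^ x.
  by rewrite /conjg !mulgA mulgVK.
by rewrite gpredJr //; exact: quotient_repr.
Qed.

Fact quotient_mulA : associative quotient_mul.
Proof.
elim/quotW=> x; elim/quotW=> y; elim/quotW=> z.
by rewrite (quotient_piM y z) (quotient_piM x y) !quotient_piM mulgA.
Qed.

Fact quotient_mul1g : left_id quotient_one quotient_mul.
Proof. by move=> u; rewrite -[u]reprK quotient_piM mul1g. Qed.

Fact quotient_mulg1 : right_id quotient_one quotient_mul.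
Proof. by move=> u; rewrite -[u]reprK quotient_piM mulg1. Qed.

Fact quotient_mulVg : left_inverse quotient_one quotient_inv quotient_mul.
Proof. by move=> u; rewrite -[u]reprK quotient_piV quotient_piM mulVg. Qed.

Fact quotient_mulgV : right_inverse quotient_one quotient_inv quotient_mul.
Proof. by move=> u; rewrite -[u]reprK quotient_piV quotient_piM mulgV. Qed.

HB.instance Definition _ := isGroup.Build quotient_group quotient_mulA
  quotient_mul1g quotient_mulg1 quotient_mulVg quotient_mulgV.

End QuotientGroup.

Section GroupProperties.
Variable gT : groupType.
Local Open Scope group_scope.

Definition generated (A : set gT) : set gT :=
  smallest [set M : set gT | group_closed [in M]] A.

Definition finitely_generated : Prop :=
  exists s : seq gT, generated [set` s] = setT.

Fixpoint derived (n : nat) : set gT :=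
  if n is m.+1 then
    generated [set [~ x, y] | x in derived m & y in derived m]
  else setT.

Definition solvable_group : Prop := exists n, derived n = [set 1].

Definition abelian_group : Prop := forall x y : gT, x * y = y * x.

End GroupProperties.

Section AdditiveGroup.
Variable gT : groupType.

Definition additive_group (cG : abelian_group gT) : Type := gT.

Variable cG : abelian_group gT.

HB.instance Definition _ := Choice.copy (additive_group cG) gT.
HB.instance Definition _ := GRing.isZmodule.Build (additive_group cG)
  (@mulgA gT) cG (@mul1g gT) (@mulVg gT).

End AdditiveGroup.

Section TensorRat.
Variable A : zmodType.

(* [:: (a1, q1); ...; (an, qn)] stands for a1 (x) q1 + ... + an (x) qn; the
   relation below is the least congruence making formal sums commutative and
   (x) biadditive. Opposites need not be adjoined: - (a (x) q) is
   (- a) (x) q. *)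
Inductive tensor_rel : seq (A * rat) -> seq (A * rat) -> Prop :=
| tensor_refl s : tensor_rel s s
| tensor_sym s t : tensor_rel s t -> tensor_rel t s
| tensor_trans s t u : tensor_rel s t -> tensor_rel t u -> tensor_rel s u
| tensor_cat s s' t t' :
    tensor_rel s s' -> tensor_rel t t' -> tensor_rel (s ++ t) (s' ++ t')
| tensor_catC s t : tensor_rel (s ++ t) (t ++ s)
| tensor_0l q : tensor_rel [:: (0, q)] [::]
| tensor_Dl a b q : tensor_rel [:: (a + b, q)] [:: (a, q); (b, q)]
| tensor_Dr a p q : tensor_rel [:: (a, p + q)] [:: (a, p); (a, q)].

Definition tensor_eq : rel (seq (A * rat)) := fun s t => `[< tensor_rel s t >].

Fact tensor_eq_refl : reflexive tensor_eq.
Proof. by move=> s; apply/asboolP; exact: tensor_refl. Qed.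

Fact tensor_eq_sym : symmetric tensor_eq.
Proof. by move=> s t; apply/asboolP/asboolP; exact: tensor_sym. Qed.

Fact tensor_eq_trans : transitive tensor_eq.
Proof.
move=> t s u /asboolP st /asboolP tu; apply/asboolP.
exact: tensor_trans st tu.
Qed.

Canonical tensor_equiv :=
  EquivRel tensor_eq tensor_eq_refl tensor_eq_sym tensor_eq_trans.

(* The tensor product of A and rat over the integers. *)
Definition tensor_rat : Type := {eq_quot tensor_equiv}.

HB.instance Definition _ := Choice.on tensor_rat.
HB.instance Definition _ := EqQuotient.on tensor_rat.

Local Notation T := tensor_rat.
Implicit Types (s t : seq (A * rat)) (u v w : T).

Fact tensor_piP s t : tensor_rel s t <-> \pi_T s = \pi_T t.
Proof.
have P := @eqquotP _ tensor_equiv T s t; split => [st|/P/asboolP//].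
by apply/P/asboolP.
Qed.

Fact tensor_repr s : tensor_rel (repr (\pi_T s)) s.
Proof. by apply/tensor_piP; rewrite reprK. Qed.

Definition tensor_zero : T := \pi_T [::].
Definition tensor_add u v : T := \pi_T (repr u ++ repr v).
Definition tensor_opp u : T := \pi_T [seq (- x.1, x.2) | x <- repr u].
Definition tensor_scale (q : rat) u : T :=
  \pi_T [seq (x.1, q * x.2) | x <- repr u].

Fact tensor_addE s t : tensor_add (\pi_T s) (\pi_T t) = \pi_T (s ++ t).
Proof. by apply/tensor_piP/tensor_cat; exact: tensor_repr. Qed.

Fact tensor_rel_opp s t : tensor_rel s t ->
  tensor_rel [seq (- x.1, x.2) | x <- s] [seq (- x.1, x.2) | x <- t].
Proof.
elim=> {s t} [s|s t _|s t u _ + _|s s' t t' _ IHs _ IHt|s t|q|a b q|a p q] /=.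
- exact: tensor_refl.
- exact: tensor_sym.
- exact: tensor_trans.
- by rewrite !map_cat; exact: tensor_cat.
- by rewrite !map_cat; exact: tensor_catC.
- by rewrite oppr0; exact: tensor_0l.
- by rewrite opprD; exact: tensor_Dl.
- exact: tensor_Dr.
Qed.

Fact tensor_oppE s :
  tensor_opp (\pi_T s) = \pi_T [seq (- x.1, x.2) | x <- s].
Proof. by apply/tensor_piP/tensor_rel_opp/tensor_repr. Qed.

Fact tensor_rel_scale r s t : tensor_rel s t ->
  tensor_rel [seq (x.1, r * x.2) | x <- s] [seq (x.1, r * x.2) | x <- t].
Proof.
elim=> {s t} [s|s t _|s t u _ + _|s s' t t' _ IHs _ IHt|s t|q|a b q|a p q] /=.
- exact: tensor_refl.
- exact: tensor_sym.
- exact: tensor_trans.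
- by rewrite !map_cat; exact: tensor_cat.
- by rewrite !map_cat; exact: tensor_catC.
- exact: tensor_0l.
- exact: tensor_Dl.
- by rewrite mulrDr; exact: tensor_Dr.
Qed.

Fact tensor_scaleE r s :
  tensor_scale r (\pi_T s) = \pi_T [seq (x.1, r * x.2) | x <- s].
Proof. by apply/tensor_piP/tensor_rel_scale/tensor_repr. Qed.

Fact tensor_addA : associative tensor_add.
Proof.
elim/quotW=> r; elim/quotW=> s; elim/quotW=> t.
by rewrite (tensor_addE s t) (tensor_addE r s) !tensor_addE catA.
Qed.

Fact tensor_addC : commutative tensor_add.
Proof.
elim/quotW=> s; elim/quotW=> t; rewrite !tensor_addE.
by apply/tensor_piP; exact: tensor_catC.
Qed.

Fact tensor_add0 : left_id tensor_zero tensor_add.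
Proof. by elim/quotW=> s; rewrite tensor_addE. Qed.

Fact tensor_addN : left_inverse tensor_zero tensor_opp tensor_add.
Proof.
elim/quotW=> s; rewrite tensor_oppE.
elim: s => [|[a q] s IHs] /=; first by rewrite tensor_addE.
rewrite -cat1s -[(a, q) :: s]cat1s -!tensor_addE.
rewrite tensor_addA -(tensor_addA (\pi_T [:: (- a, q)])).
rewrite (tensor_addC _ (\pi_T [:: (a, q)])) tensor_addA -tensor_addA IHs.
rewrite !tensor_addE cats0; apply/tensor_piP.
apply: tensor_trans (tensor_0l q); rewrite -(addNr a).
exact/tensor_sym/tensor_Dl.
Qed.

HB.instance Definition _ := GRing.isZmodule.Build tensor_rat
  tensor_addA tensor_addC tensor_add0 tensor_addN.

Fact tensor_scaleA p q u :
  tensor_scale p (tensor_scale q u) = tensor_scale (p * q) u.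
Proof.
elim/quotW: u => s.
rewrite (tensor_scaleE q) (tensor_scaleE p) (tensor_scaleE (p * q)) -map_comp.
by apply/(congr1 (\pi_T))/eq_map => x /=; rewrite mulrA.
Qed.

Fact tensor_scale1 : left_id 1 tensor_scale.
Proof.
elim/quotW=> s; rewrite tensor_scaleE; apply: (congr1 (\pi_T)).
by rewrite -[RHS]map_id; apply: eq_map => -[a q] /=; rewrite mul1r.
Qed.

Fact tensor_scaleDr : right_distributive tensor_scale +%R.
Proof.
move=> q; elim/quotW=> s; elim/quotW=> t.
by rewrite /+%R /= !(tensor_addE, tensor_scaleE) map_cat.
Qed.

Fact tensor_scaleDl u : {morph tensor_scale^~ u : p q / p + q}.
Proof.
elim/quotW: u => s p q; rewrite !tensor_scaleE.
elim: s => [|[a r] s IHs] /=; first by rewrite [RHS]tensor_addE.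
rewrite -cat1s -[(a, p * r) :: _]cat1s -[(a, q * r) :: _]cat1s.
have piD (s1 t1 : seq (A * rat)) : \pi_T (s1 ++ t1) = \pi_T s1 + \pi_T t1.
  by rewrite -tensor_addE.
rewrite 3!piD IHs addrACA; congr (_ + _).
rewrite -piD; apply/tensor_piP; rewrite mulrDl; exact: tensor_Dr.
Qed.

HB.instance Definition _ := GRing.Zmodule_isLmodule.Build rat tensor_rat
  tensor_scaleA tensor_scale1 tensor_scaleDr tensor_scaleDl.

End TensorRat.

Definition lin_independent (K : fieldType) (V : lmodType K) (n : nat)
    (v : 'I_n -> V) : Prop :=
  forall c : 'I_n -> K, \sum_i c i *: v i = 0 -> forall i, c i = 0.

(* dim_K V > n; V may be infinite dimensional. *)
Definition dim_gt (K : fieldType) (V : lmodType K) (n : nat) : Prop :=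
  exists v : 'I_n.+1 -> V, lin_independent v.

Definition rank_gt (gT : groupType) (cG : abelian_group gT) (n : nat) : Prop :=
  dim_gt (tensor_rat (additive_group cG)) n.

Section Homeomorphisms.
Context {d : Order.disp_t} (T : POrderedTopological.type d).

(* On a line or an interval, preserving orientation means being increasing. *)
Record homeo : Type := Homeo {
  homeo_fun :> T -> T;
  homeo_inv : T -> T;
  homeo_funK : cancel homeo_fun homeo_inv;
  homeo_invK : cancel homeo_inv homeo_fun;
  homeo_continuous : continuous homeo_fun;
  homeo_inv_continuous : continuous homeo_inv;
  homeo_mono : {mono homeo_fun : x y / (x <= y)%O}
}.

HB.instance Definition _ := gen_eqMixin homeo.
HB.instance Definition _ := gen_choiceMixin homeo.

Implicit Types f g h : homeo.

Fact homeo_eq f g : f =1 g -> f = g.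
Proof.
case: f g => f f' fK f'K cf cf' incf [g g' gK g'K cg cg' incg] /= fg.
have {}fg : f = g by exact/funext.
subst g; have fg' : f' = g' by apply/funext => x; rewrite -{1}[x]g'K fK.
by subst g'; congr Homeo; exact: Prop_irrelevance.
Qed.

Definition homeo_one : homeo :=
  @Homeo id id (frefl _) (frefl _) (fun=> cvg_id) (fun=> cvg_id)
    (fun _ _ => erefl).

Fact homeo_inv_mono f : {mono homeo_inv f : x y / (x <= y)%O}.
Proof. by move=> x y; rewrite -(homeo_mono f) !homeo_invK. Qed.

Definition homeo_group_inv f : homeo :=
  Homeo (@homeo_invK f) (@homeo_funK f) (@homeo_inv_continuous f)
    (@homeo_continuous f) (@homeo_inv_mono f).

Fact homeo_mul_funK f g :
  cancel (g \o f) (homeo_inv f \o homeo_inv g).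
Proof. exact: can_comp (@homeo_funK g) (@homeo_funK f). Qed.

Fact homeo_mul_invK f g :
  cancel (homeo_inv f \o homeo_inv g) (g \o f).
Proof. exact: can_comp (@homeo_invK f) (@homeo_invK g). Qed.

Fact homeo_mul_continuous f g : continuous (g \o f).
Proof.
by move=> x; apply: continuous_comp; exact: homeo_continuous.
Qed.

Fact homeo_mul_inv_continuous f g : continuous (homeo_inv f \o homeo_inv g).
Proof.
by move=> x; apply: continuous_comp; exact: homeo_inv_continuous.
Qed.

Fact homeo_mul_mono f g : {mono g \o f : x y / (x <= y)%O}.
Proof. by move=> x y /=; rewrite !homeo_mono. Qed.

(* The groups act on the right: x . (f * g) = (x . f) . g, where x . f is
   the value f x. *)
Definition homeo_mul f g : homeo :=
  Homeo (@homeo_mul_funK f g) (@homeo_mul_invK f g)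
    (@homeo_mul_continuous f g) (@homeo_mul_inv_continuous f g)
    (@homeo_mul_mono f g).

Fact homeo_mulA : associative homeo_mul.
Proof. by move=> f g h; exact: homeo_eq. Qed.

Fact homeo_mul1 : left_id homeo_one homeo_mul.
Proof. by move=> f; exact: homeo_eq. Qed.

Fact homeo_mulr1 : right_id homeo_one homeo_mul.
Proof. by move=> f; exact: homeo_eq. Qed.

Fact homeo_mulV : left_inverse homeo_one homeo_group_inv homeo_mul.
Proof. by move=> f; apply: homeo_eq => x /=; rewrite homeo_invK. Qed.

Fact homeo_mulrV : right_inverse homeo_one homeo_group_inv homeo_mul.
Proof. by move=> f; apply: homeo_eq => x /=; rewrite homeo_funK. Qed.

HB.instance Definition _ := isGroup.Build homeo
  homeo_mulA homeo_mul1 homeo_mulr1 homeo_mulV homeo_mulrV.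

End Homeomorphisms.

(* A point x of the line has two groups of germs, G_x / G_x^+ (RightOf x) and
   G_x / G_x^- (LeftOf x); each end of the line has only one. *)
Inductive germ_place (R : realType) : Type :=
| RightOf of R
| LeftOf of R
| PlusInfinity
| MinusInfinity.
Arguments PlusInfinity {R}.
Arguments MinusInfinity {R}.

Section Germs.
Variable R : realType.
Implicit Types (e : germ_place R) (f g : homeo R).

Definition fixes_place e g : bool :=
  match e with
  | RightOf x | LeftOf x => g x == x
  | PlusInfinity | MinusInfinity => true
  end.

Definition trivial_germ e g : Prop :=
  match e with
  | RightOf x =>
      exists2 delta, 0 < delta & forall y, x <= y <= x + delta -> g y = y
  | LeftOf x =>
      exists2 delta, 0 < delta & forall y, x - delta <= y <= x -> g y = y
  | PlusInfinity => exists r, forall y, r < y -> g y = y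
  | MinusInfinity => exists r, forall y, y < r -> g y = y
  end.

Fact homeo_inv_fix f y : f y = y -> homeo_inv f y = y.
Proof. by move=> fy; rewrite -{1}fy homeo_funK. Qed.

Fact trivial_germ1 e : trivial_germ e (1%g : homeo R).
Proof. by case: e => [x|x||] /=; try exists 1; try exists 0. Qed.

Fact trivial_germV e g : trivial_germ e g -> trivial_germ e (g^-1)%g.
Proof.
case: e => [x|x||] /= [r].
- by move=> r0 gr; exists r => // y /gr; exact: homeo_inv_fix.
- by move=> r0 gr; exists r => // y /gr; exact: homeo_inv_fix.
- by move=> gr; exists r => y /gr; exact: homeo_inv_fix.
- by move=> gr; exists r => y /gr; exact: homeo_inv_fix.
Qed.

Fact trivial_germM e f g :
  trivial_germ e f -> trivial_germ e g -> trivial_germ e (f * g)%g.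
Proof.
case: e => [x|x||] /= [r].
- move=> r0 fr [q q0 gq]; exists (Num.min r q); first by rewrite lt_min r0.
  move=> y /andP[xy]; rewrite -lerBlDl le_min !lerBlDl => /andP[yr yq].
  by rewrite fr ?xy // gq ?xy.
- move=> r0 fr [q q0 gq]; exists (Num.min r q); first by rewrite lt_min r0.
  move=> y /andP[yr xy]; move: yr; rewrite lerBlDl -lerBlDr le_min.
  by rewrite !lerBlDr -!lerBlDl => /andP[yr yq]; rewrite fr ?yr // gq ?yq.
- move=> fr [q gq]; exists (Num.max r q) => y.
  by rewrite gt_max => /andP[ry qy]; rewrite fr // gq.
- move=> fr [q gq]; exists (Num.min r q) => y.
  by rewrite lt_min => /andP[ry qy]; rewrite fr // gq.
Qed.

Fact trivial_germJ e g h :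
  fixes_place e h -> trivial_germ e g -> trivial_germ e (g ^ h)%g.
Proof.
have J y : g (homeo_inv h y) = homeo_inv h y -> (g ^ h)%g y = y.
  by move=> gy; rewrite /= gy homeo_invK.
have hlt : {mono h : y z / y < z} by exact: (leW_mono (@homeo_mono _ _ h)).
have hVle y z : (homeo_inv h y <= z) = (y <= h z).
  by rewrite -(homeo_mono h) homeo_invK.
have hleV y z : (z <= homeo_inv h y) = (h z <= y).
  by rewrite -(homeo_mono h) homeo_invK.
case: e => [x|x||].
- move=> /eqP hx [r r0 gr]; exists (h (x + r) - x).
    by rewrite subr_gt0 -{1}hx hlt ltrDl.
  move=> y; rewrite addrC subrK => /andP[xy yr]; apply/J/gr.
  by rewrite hleV hx xy hVle.
- move=> /eqP hx [r r0 gr]; exists (x - h (x - r)).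
    by rewrite subr_gt0 -{2}hx hlt ltrBlDr ltrDl.
  move=> y; rewrite subKr => /andP[xy yr]; apply/J/gr.
  by rewrite hleV xy hVle hx.
- move=> _ [r gr]; exists (h r) => y ry; apply/J/gr.
  by rewrite -hlt homeo_invK.
- move=> _ [r gr]; exists (h r) => y ry; apply/J/gr.
  by rewrite -hlt homeo_invK.
Qed.

Section GroupOfGerms.
Variables (G : groupClosed (homeo R)) (e : germ_place R).

Definition stabiliser : {pred homeo R} :=
  [pred g | (g \in G) && fixes_place e g].

Fact stabiliser_closed : group_closed stabiliser.
Proof.
split=> [|f g]; rewrite !inE; first by rewrite gpred1; case: e => //= x.
move=> /andP[Gf ef] /andP[Gg eg]; rewrite gpredF //.
have E x : f x == x -> g x == x -> (f / g)%g x == x.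
  by move=> /eqP fx /eqP gx; apply/eqP; rewrite -[RHS](homeo_funK g) gx /= fx.
by case: e ef eg => //= x; exact: E.
Qed.

HB.instance Definition _ :=
  isInvClosed.Build _ stabiliser (group_closedV stabiliser_closed).
HB.instance Definition _ := isMulClosed.Build _ stabiliser
  (group_closedM stabiliser_closed).
HB.instance Definition _ :=
  isMul1Closed.Build _ stabiliser stabiliser_closed.1.

Definition germ_kernel : {pred subgroup stabiliser} :=
  [pred g | `[< trivial_germ e (subgroup_val g) >]].

Fact germ_kernel_closed : group_closed germ_kernel.
Proof.
split=> [|f g]; rewrite !inE; first exact: trivial_germ1.
by move=> tf tg; exact: trivial_germM tf (trivial_germV tg).
Qed.

Fact germ_kernel_normal :
  {in germ_kernel, forall x y, (x ^ y)%g \in germ_kernel}.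
Proof.
move=> f; rewrite inE => tf h; rewrite inE.
have /andP[_ eh] := subgroup_valP h.
exact: trivial_germJ eh tf.
Qed.

HB.instance Definition _ :=
  isInvClosed.Build _ germ_kernel (group_closedV germ_kernel_closed).
HB.instance Definition _ := isMulClosed.Build _ germ_kernel
  (group_closedM germ_kernel_closed).
HB.instance Definition _ :=
  isMul1Closed.Build _ germ_kernel germ_kernel_closed.1.
HB.instance Definition _ :=
  isNormalClosed.Build _ germ_kernel germ_kernel_normal.

Definition germ_group : groupType := quotient_group germ_kernel.

End GroupOfGerms.

Definition minimal_action (G : groupClosed (homeo R)) : Prop :=
  forall x, dense [set g x | g in [set` G]].

Definition coherent (G : groupClosed (homeo R)) : Prop :=
  [/\ minimal_action G,
      solvable_group (germ_group G PlusInfinity) /\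
      solvable_group (germ_group G MinusInfinity),
      exists2 g, g \in G & trivial_germ MinusInfinity g /\
        (exists r, forall y, r < y -> g y <> y)
    & exists2 g, g \in G & trivial_germ PlusInfinity g /\
        (exists s, forall y, y < s -> g y <> y)].

End Germs.

Definition unit_interval (R : realType) : Type :=
  set_type (`[0, 1]%classic : set R).

HB.instance Definition _ R := Topological.on (unit_interval R).
HB.instance Definition _ R := SubChoice.on (unit_interval R).
HB.instance Definition _ (R : realType) :=
  [SubChoice_isSubOrder of unit_interval R by <: with ring_display].

Section Thompson.
Variable R : realType.
Local Notation I := (unit_interval R).
Implicit Types (f g : homeo I) (a b c x y : I).

Definition dyadic (x : R) : Prop :=
  exists (m : int) (n : nat), x = m%:~R / 2 ^+ n.

Definition affine_pow2 f a b : Prop :=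
  exists (k : int) (t : R),
    forall x, a <= x <= b -> val (f x) = 2 ^ k * val x + t.

(* f has no breakpoint outside s; on each interval without breakpoints its
   derivative is the slope 2 ^ k. *)
Definition thompson_map f : Prop :=
  exists2 s : seq I, (forall c, c \in s -> dyadic (val c)) &
    forall a b, (forall c, c \in s -> ~~ (a < c < b)) -> affine_pow2 f a b.

Fact dyadicD (p q : R) : dyadic p -> dyadic q -> dyadic (p + q).
Proof.
move=> [m [n ->]] [m' [n' ->]]; exists (m * 2 ^+ n' + m' * 2 ^+ n), (n + n')%N.
have N0 k : (2 ^+ k : R) != 0 by rewrite expf_neq0 // pnatr_eq0.
by rewrite exprD rmorphD /= !rmorphM /= !rmorphXn /= addf_div ?N0.
Qed.

Fact dyadicN (p : R) : dyadic p -> dyadic (- p).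
Proof. by move=> [m [n ->]]; exists (- m), n; rewrite rmorphN mulNr. Qed.

Fact dyadic_pow2M (k : int) (p : R) : dyadic p -> dyadic (2 ^ k * p).
Proof.
move=> [m [n ->]]; case: k => k.
  by exists (2 ^+ k * m), n; rewrite rmorphM /= rmorphXn /= mulrA.
by exists m, (k.+1 + n)%N; rewrite [LHS]mulrCA exprD invfM.
Qed.

Fact ltn_count (T : eqType) (p q : pred T) (s : seq T) (z : T) :
  subpred p q -> z \in s -> q z -> ~~ p z -> (count p s < count q s)%N.
Proof.
move=> pq; elim: s => //= d s IHs; rewrite inE => /orP[/eqP <- qz pz|zs qz pz].
  by rewrite qz (negPf pz) add0n add1n ltnS; exact: sub_count.
by rewrite -addnS leq_add ?IHs //; case: (p d) (pq d) => // ->.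
Qed.

Fact unit_interval_ge0 x : 0 <= val x.
Proof. by case: x => x /= /set_mem /=; rewrite in_itv /= => /andP[]. Qed.

Fact unit_interval_0P : (0 : R) \in (`[0, 1]%classic : set R).
Proof. by apply/mem_set; rewrite /= in_itv /= lexx ler01. Qed.

Definition unit_interval_0 : I := exist _ 0 unit_interval_0P.

Fact unit_interval_0_le x : unit_interval_0 <= x.
Proof. exact: unit_interval_ge0. Qed.

Fact homeo_unit_0 f : f unit_interval_0 = unit_interval_0.
Proof.
apply/eqP; rewrite eq_le unit_interval_0_le andbT.
rewrite -[X in _ <= X](homeo_invK f) homeo_mono.
exact: unit_interval_0_le.
Qed.

Fact thompson_dyadic f : thompson_map f ->
  forall x, dyadic (val x) -> dyadic (val (f x)).
Proof.
move=> [s sd sf] x xd; move: (unit_interval_0_le x).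
have : dyadic (val unit_interval_0) by exists 0, 0%N; rewrite /= mul0r.
have : dyadic (val (f unit_interval_0)).
  by rewrite homeo_unit_0; exists 0, 0%N; rewrite /= mul0r.
move: unit_interval_0 => a.
have [n] := ubnP (count [pred c | a < c < x] s).
elim: n => // n IHn in a x xd * => cn fad ad ax.
have [/hasP[c cs /= /andP[ac cx]]|/hasPn nos] :=
  boolP (has [pred c | a < c < x] s).
  have cd : dyadic (val (f c)).
    apply: (IHn a c (sd _ cs)) (ltW ac) => //; rewrite -ltnS.
    apply: leq_trans cn; rewrite ltnS.
    apply: (@ltn_count _ _ _ _ c) => //=; last by rewrite ltxx andbF.
      by move=> b /= /andP[-> bc]; exact: lt_trans cx.
    by rewrite ac.
  apply: (IHn c x xd) (ltW cx) => //; last exact: sd.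
  rewrite -ltnS; apply: leq_trans cn; rewrite ltnS.
  apply: (@ltn_count _ _ _ _ c) => //=; last by rewrite ltxx.
    by move=> b /= /andP[cb ->]; rewrite (lt_trans ac cb).
  by rewrite ac.
have [k [t kt]] := sf a x nos.
have -> : val (f x) = val (f a) + 2 ^ k * (val x - val a).
  rewrite (kt a) ?lexx // (kt x) ?lexx ?andbT //.
  by rewrite mulrBr [RHS]addrC addrA subrK.
by apply/(dyadicD fad)/dyadic_pow2M/dyadicD => //; exact: dyadicN.
Qed.

Definition thompson_pred : {pred homeo I} := [pred f | `[< thompson_map f >]].

Fact homeo_lt f x y : (f x < f y) = (x < y).
Proof. exact: (leW_mono (@homeo_mono _ _ f)). Qed.

Fact thompson_map1 : thompson_map 1%g.
Proof.
by exists [::] => // a b _; exists 0, 0 => x _; rewrite expr0z mul1r addr0.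
Qed.

Fact thompson_mapV f : thompson_map f -> thompson_map (f^-1)%g.
Proof.
move=> tf; have [s sd sf] := tf; exists [seq f c | c <- s].
  by move=> _ /mapP[c cs ->]; exact/thompson_dyadic/sd.
move=> a b sab; have [|k [t kt]] := sf (homeo_inv f a) (homeo_inv f b).
  move=> c cs; rewrite -(homeo_lt f _ c) -(homeo_lt f c) !homeo_invK.
  by apply: sab; exact: map_f.
exists (- k), (- (2 ^ (- k) * t)) => x /andP[ax xb].
have := kt (homeo_inv f x); rewrite !homeo_inv_mono ax xb homeo_invK.
move=> /(_ isT) ->; rewrite mulrDr mulrA -expfzDr ?pnatr_eq0 //.
by rewrite addNr expr0z mul1r addrK.
Qed.

Fact thompson_mapM f g :
  thompson_map f -> thompson_map g -> thompson_map (f * g)%g.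
Proof.
move=> tf tg; have [s sd sf] := tf; have [r rd rg] := tg.
exists (s ++ [seq homeo_inv f c | c <- r]).
  move=> c; rewrite mem_cat => /orP[/sd //|/mapP[b br ->]].
  exact/(thompson_dyadic (thompson_mapV tf))/rd.
move=> a b sab; have [|k [t kt]] := sf a b.
  by move=> c cs; apply: sab; rewrite mem_cat cs.
have [|l [u lu]] := rg (f a) (f b).
  move=> c cr; rewrite -(homeo_invK f c) !homeo_lt; apply: sab.
  by rewrite mem_cat map_f ?orbT.
exists (l + k), (2 ^ l * t + u) => x axb.
have := lu (f x); rewrite !homeo_mono axb => /(_ isT) E.
by rewrite [LHS]E (kt x) // expfzDr ?pnatr_eq0 // mulrDr mulrA addrA.
Qed.

Fact thompson_closed : group_closed thompson_pred.
Proof.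
split=> [|f g]; rewrite !inE; first exact: thompson_map1.
by move=> tf tg; exact: thompson_mapM tf (thompson_mapV tg).
Qed.

HB.instance Definition _ :=
  isInvClosed.Build _ thompson_pred (group_closedV thompson_closed).
HB.instance Definition _ := isMulClosed.Build _ thompson_pred
  (group_closedM thompson_closed).
HB.instance Definition _ :=
  isMul1Closed.Build _ thompson_pred thompson_closed.1.

Definition thompsonF : groupType := subgroup thompson_pred.

End Thompson.

Definition embeds (gT hT : groupType) : Prop :=
  exists phi : {multiplicative gT -> hT}, injective phi.

(* Main.v *)
Require Import Defs.
From mathcomp Require Import all_boot all_order all_algebra.
From mathcomp Require Import all_classical all_reals all_analysis.
From mathcomp Require Import ring lra.
Import numFieldNormedType.Exports.

Set Implicit Arguments.
Unset Strict Implicit.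
Unset Printing Implicit Defensive.

Import Order.TTheory GRing.Theory Num.Theory.

(** Let [a] be the given action of [G] on the line and let [b] be the action
    on I = [0,1] obtained from an embedding of [G] into F.  The proof carries
    the line into the interval: there is a strictly monotone map [s] from the
    line to I with [s (a g x) = b g (s x)] for all [g]
    (equivariant_strictly_monotone).

    Such a map bounds the germs.  If [g] fixes a place [e] of the line, then
    [b g] fixes the limit [p] of [s] at [e]; and if [b g] is the identity near
    [p], on the side from which [s] approaches it, then [g] is the identity
    near [e], because [s] is injective.  So the group of germs at [e] is a
    quotient of a group of one-sided germs of elements of F at [p], and these
    germs are determined by the exponent of 2 in their slope, an integer.  A
    quotient of a subgroup of Z is abelian of rank at most 1
    (germ_group_rank_le1).

    To find [s], let U x (resp. V x) be the set of points of I moved by [b k]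
    for some commutator [k] of two elements of [G] that are supported in one
    compact interval of the line lying to the left (resp. to the right) of x.
    Elements supported on different sides of x commute, and commutation is
    rigid in F: if f and g commute with h, then the commutator of f and g is
    the identity on the support of h (commutator_of_commuting_fixes).  Hence
    U x and V x are disjoint.  They are also open, equivariant in x, and
    monotone in x, so that x |-> inf (U x) and x |-> inf (V x) are equivariant
    monotone maps.  As [G] maps any compact interval of the line into any open
    one (proximal), each of them is either constant or strictly monotone.

    They are not both constant (no_common_infimum).  Otherwise their common
    value c is fixed by [G], and U x and V x accumulate at c for every x.  A
    compactly supported commutator [k] then acts as the identity on some
    interval from c to c + e, since its germ at c is linear and the support of
    [b k] misses some V x.  Choose [k] moving the point 0 of the line.  A point
    of (c, c + e) outside U 0 and V 0 is fixed by [b k], so it is outside U y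
    and V y as well, where y is the image of 0; and for x < z every point moved
    by some compactly supported commutator lies in U z or in V x
    (moved_overlap).  So such a point, call it a gap, is fixed by all these
    commutators.  Now U 0 and V 0 are open and disjoint, so gaps exist between
    a point of U 0 and a point of V 0.  But a point of U 0 close to c can be
    pushed into V 0 by a product of compactly supported commutators, which
    cannot cross a gap. *)

(** * Actions by increasing homeomorphisms *)
Section Actions.
Context {d : Order.disp_t} {T : POrderedTopological.type d} {Gt : groupType}.
Variable a : {multiplicative Gt -> homeo T}.
Implicit Types (g h : Gt) (x y z : T) (D : Gt -> Prop) (S : T -> Prop).

Lemma actM g h x : a (g * h)%g x = a h (a g x).
Proof. by rewrite gmulfM. Qed.

Lemma act1 x : a 1%g x = x.
Proof.
have /(congr1 (homeo_inv (a 1%g))) := actM 1 1 x.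
by rewrite mulg1 !homeo_funK => <-.
Qed.

Lemma actK g : cancel (a g) (a g^-1%g).
Proof. by move=> x; rewrite -actM mulgV act1. Qed.

Lemma actVK g : cancel (a g^-1%g) (a g).
Proof. by move=> x; rewrite -actM mulVg act1. Qed.

Lemma act_inj g : injective (a g).
Proof. exact: can_inj (@actK g). Qed.

Lemma act_le g : {mono a g : x y / (x <= y)%O}.
Proof. exact: homeo_mono. Qed.

Lemma act_lt g : {mono a g : x y / (x < y)%O}.
Proof. exact: leW_mono (@act_le g). Qed.

Lemma act_leV g x y : (a g^-1%g x <= y)%O = (x <= a g y)%O.
Proof. by rewrite -(act_le g) actVK. Qed.

Lemma act_ltV g x y : (a g^-1%g x < y)%O = (x < a g y)%O.
Proof. by rewrite -(act_lt g) actVK. Qed.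

Lemma act_geV g x y : (x <= a g^-1%g y)%O = (a g x <= y)%O.
Proof. by rewrite -(act_le g) actVK. Qed.

Lemma act_gtV g x y : (x < a g^-1%g y)%O = (a g x < y)%O.
Proof. by rewrite -(act_lt g) actVK. Qed.

Lemma act_fixV g x : a g x = x -> a g^-1%g x = x.
Proof. by move=> gx; rewrite -{1}gx actK. Qed.

Lemma act_inv g : a g^-1%g = (a g)^-1%g.
Proof.
by apply: homeo_eq => x; rewrite -{1}[x](homeo_invK (a g)) actK.
Qed.

Lemma act_commutator g h : a [~ g, h]%g = [~ a g, a h]%g.
Proof. by rewrite !commgEl !conjgE !gmulfM !act_inv. Qed.

Lemma act_conj g h x : a (g ^ h)%g (a h x) = a h (a g x).
Proof. by rewrite conjgE !actM actK. Qed.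

Lemma act_commute g h x : commute g h -> a g (a h x) = a h (a g x).
Proof. by move=> gh; rewrite -!actM gh. Qed.

Lemma nontrivial_moves g : injective a -> g <> 1%g -> exists x, a g x <> x.
Proof.
move=> a_inj g1; apply: contrapT => no; apply/g1/a_inj/homeo_eq => x.
by rewrite act1; apply: contrapT => gx; apply: no; exists x.
Qed.

Definition subgroup_pred D :=
  [/\ D 1%g, forall g h, D g -> D h -> D (g * h)%g & forall g, D g -> D g^-1%g].

Lemma fixing_subgroup S : subgroup_pred (fun g => forall x, S x -> a g x = x).
Proof.
split=> [x _|g h gS hS x xS|g gS x xS]; first exact: act1.
- by rewrite actM gS // hS.
- exact/act_fixV/gS.
Qed.

(** Bounds are given by their universal property, which makes sense on the
    line and on the interval alike. *)
Definition least_upper S m :=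
  (forall y, S y -> (y <= m)%O) /\
  (forall z, (forall y, S y -> (y <= z)%O) -> (m <= z)%O).

Definition greatest_lower S m :=
  (forall y, S y -> (m <= y)%O) /\
  (forall z, (forall y, S y -> (z <= y)%O) -> (z <= m)%O).

Definition in_orbit D x y := exists2 g, D g & y = a g x.

Definition stable_under D S := forall g x, D g -> S x -> S (a g x).

Lemma orbit_stable D x : subgroup_pred D -> stable_under D (in_orbit D x).
Proof.
by move=> [_ DM _] g _ Dg [h Dh ->]; exists (h * g)%g; [exact: DM|rewrite actM].
Qed.

Lemma orbit_refl D x : subgroup_pred D -> in_orbit D x x.
Proof. by case=> D1 _ _; exists 1%g; rewrite ?act1. Qed.

(** The least upper bound of a set is carried by a homeomorphism preserving
    the set to another upper bound, hence cannot move down, in either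
    direction.  This replaces limits of iterates throughout. *)
Lemma least_upper_fixed D S m : subgroup_pred D -> stable_under D S ->
  least_upper S m -> forall g, D g -> a g m = m.
Proof.
move=> [_ _ DV] DS [ub least].
have mg g : D g -> (m <= a g m)%O.
  move=> Dg; apply: least => y yS; rewrite -act_leV; apply: ub.
  exact: DS (DV _ Dg) yS.
by move=> g Dg; apply/le_anti; rewrite (mg g) // -act_geV (mg _ (DV _ Dg)).
Qed.

Lemma greatest_lower_fixed D S m : subgroup_pred D -> stable_under D S ->
  greatest_lower S m -> forall g, D g -> a g m = m.
Proof.
move=> [_ _ DV] DS [lb greatest].
have mg g : D g -> (a g m <= m)%O.
  move=> Dg; apply: greatest => y yS; rewrite -act_geV; apply: lb.
  exact: DS (DV _ Dg) yS.
by move=> g Dg; apply/le_anti; rewrite (mg g) // -act_leV (mg _ (DV _ Dg)).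
Qed.

Lemma point_stabiliser_subgroup x : subgroup_pred (fun g => a g x = x).
Proof.
split=> [|g h gx hx|g]; [exact: act1|by rewrite actM gx|exact: act_fixV].
Qed.

End Actions.

(** * Orbits on the line *)
Section Line.
Local Open Scope ring_scope.
Context {R : realType}.

Lemma real_least_upper (S : R -> Prop) (x b : R) :
  S x -> (forall y, S y -> y <= b) -> exists m : R, least_upper S m.
Proof.
move=> Sx Sb; exists (sup S).
have ex : nonempty (S : set R) by exists x.
have hub : has_ubound S by exists b.
split=> [y Sy|z Sz]; first exact: ub_le_sup.
exact: ge_sup.
Qed.

Lemma real_greatest_lower (S : R -> Prop) (x b : R) :
  S x -> (forall y, S y -> b <= y) -> exists m : R, greatest_lower S m.
Proof.
move=> Sx Sb; exists (inf S).
have ex : nonempty (S : set R) by exists x.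
have hub : has_lbound S by exists b.
split=> [y Sy|z Sz]; first exact: ge_inf.
exact: lb_le_inf.
Qed.

Context {Gt : groupType}.
Variable a : {multiplicative Gt -> homeo R}.
Implicit Types (g h k : Gt) (x y z : R) (D : Gt -> Prop).

(** The supremum of a bounded orbit would be a common fixed point. *)
Lemma orbit_unbounded_above D u y : subgroup_pred D ->
  (forall z, z <= u -> exists2 g, D g & a g z <> z) ->
  exists2 g, D g & u < a g y.
Proof.
move=> Dgrp moved; have [//|no] := pselect (exists2 g, D g & u < a g y).
have le_u z : in_orbit a D y z -> z <= u.
  by move=> [g Dg ->]; rewrite leNgt; apply/negP=> ug; apply: no; exists g.
have [m lub] := real_least_upper (orbit_refl a y Dgrp) le_u.
have mu : m <= u by apply: lub.2.
have [g Dg] := moved _ mu.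
by rewrite (least_upper_fixed Dgrp (orbit_stable Dgrp) lub Dg).
Qed.

Lemma orbit_unbounded_below D u y : subgroup_pred D ->
  (forall z, u <= z -> exists2 g, D g & a g z <> z) ->
  exists2 g, D g & a g y < u.
Proof.
move=> Dgrp moved; have [//|no] := pselect (exists2 g, D g & a g y < u).
have ge_u z : in_orbit a D y z -> u <= z.
  by move=> [g Dg ->]; rewrite leNgt; apply/negP=> ug; apply: no; exists g.
have [m glb] := real_greatest_lower (orbit_refl a y Dgrp) ge_u.
have um : u <= m by apply: glb.2.
have [g Dg] := moved _ um.
by rewrite (greatest_lower_fixed Dgrp (orbit_stable Dgrp) glb Dg).
Qed.

End Line.

(** * Supports in the line *)
Section Support.
Local Open Scope ring_scope.
Context {R : realType} {Gt : groupType}.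
Variable a : {multiplicative Gt -> homeo R}.
Implicit Types (f g h k : Gt) (x y z p q : R).

Definition fixed k y := a k y = y.

Lemma centraliser_subgroup k : subgroup_pred (commute k).
Proof.
split=> [|g h|g]; [exact: commute1|exact: commuteM|exact: commuteV].
Qed.

Lemma fixed_stable k : stable_under a (commute k) (fixed k).
Proof. by move=> g y kg ky; rewrite /fixed (act_commute _ _ kg) ky. Qed.

(** For [q <= p] this says that the element is trivial. *)
Definition supported_in p q f := forall y, y <= p \/ q <= y -> a f y = y.

Lemma supported_inJ p q f h :
  supported_in p q f -> supported_in (a h p) (a h q) (f ^ h)%g.
Proof.
move=> fs y; rewrite -[y](actVK a h) !act_le => /fs fy.
by rewrite act_conj fy.
Qed.

(** An element supported in [p, q] preserves the half-line below [q], on which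
    the other one is the identity, and symmetrically above [p']. *)
Lemma supported_in_commute p q p' q' f f' : injective a ->
  supported_in p q f -> supported_in p' q' f' -> q <= p' -> commute f f'.
Proof.
move=> a_inj fs fs' qp'; apply/a_inj/homeo_eq => y; rewrite !actM.
have [yq|/ltW qy] := leP y q.
  have fyq : a f y <= q by rewrite -(fs q) ?act_le //; right.
  rewrite (fs' (a f y)); last by left; exact: le_trans qp'.
  by rewrite (fs' y) //; left; exact: le_trans qp'.
have qfy : q <= a f' y by rewrite -(fs' q) ?act_le //; left.
by rewrite (fs y) ?(fs (a f' y)) //; right.
Qed.

Lemma commutator_fix f g y :
  fixed f y -> fixed f (a g^-1%g y) -> fixed [~ f, g]%g y.
Proof.
by move=> fy fgy; rewrite /fixed commgEl conjgE !actM (act_fixV fy) fgy actVK.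
Qed.

Definition compactly_supported k := exists p q, supported_in p q k.

(** Commutators rather than arbitrary elements of an interval, because it is
    commutators that act trivially on the support of what they commute with in
    F. *)
Definition local_commutator p q k :=
  exists f g, [/\ supported_in p q f, supported_in p q g & k = [~ f, g]%g].

Lemma local_commutatorJ p q k h :
  local_commutator p q k -> local_commutator (a h p) (a h q) (k ^ h)%g.
Proof.
move=> [f [g [fs gs ->]]]; exists (f ^ h)%g, (g ^ h)%g.
by split; [exact: supported_inJ|exact: supported_inJ|rewrite conjRg].
Qed.

Lemma local_commutatorV p q k :
  local_commutator p q k -> local_commutator p q k^-1%g.
Proof. by move=> [f [g [fs gs ->]]]; exists g, f; rewrite invgR. Qed.

Lemma local_commutator_supported p q k :
  local_commutator p q k -> supported_in p q k.
Proof.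
move=> [f [g [fs gs ->]]] y pqy; apply: commutator_fix; first exact: fs.
by rewrite /fixed (act_fixV (gs _ pqy)) fs.
Qed.

End Support.

(** * Coherent actions are proximal *)
Section Coherent.
Local Open Scope ring_scope.
Context {R : realType} {Gt : groupType}.
Variable a : {multiplicative Gt -> homeo R}.
Implicit Types (f g h k : Gt) (x y z p q : R).
Hypothesis a_inj : injective a.
Hypothesis orbit_dense : forall x u v, u < v -> exists g, u < a g x < v.
Hypothesis right_element : exists g, (exists r, forall y, y < r -> a g y = y) /\
  (exists r, forall y, r < y -> a g y <> y).
Hypothesis left_element : exists h, (exists s, forall y, s < y -> a h y = y) /\
  (exists s, forall y, y < s -> a h y <> y).

(** Density of orbits lets the last fixed point [q] of an element that is
    trivial near minus infinity be placed arbitrarily far to the left. *)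
Lemma right_element_conj u : exists g q, [/\ q < u,
  exists r, forall y, y < r -> a g y = y & least_upper (fixed a g) q].
Proof.
have [g [[r gr] [s gs]]] := right_element.
have [q [ub least]] : exists q, least_upper (fixed a g) q.
  apply: (@real_least_upper _ (fixed a g) (r - 1) s) => [|y gy].
    by apply: gr; rewrite ltrBlDr ltrDl.
  by rewrite leNgt; apply/negP => /gs.
have [|h /andP[_ hq]] := @orbit_dense q (u - 1) u; first by rewrite ltrBlDr ltrDl.
exists (g ^ h)%g, (a h q); split=> //.
  exists (a h r) => y; rewrite -[y](actVK a h) act_lt => /gr gy.
  by rewrite act_conj gy.
have E y : fixed a (g ^ h)%g (a h y) <-> fixed a g y.
  by rewrite /fixed act_conj; split=> [/act_inj|->].
split=> [y|z zub].
  by rewrite -[y](actVK a h) E act_le; exact: ub.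
rewrite -act_geV; apply: least => y /E/zub.
by rewrite -act_geV.
Qed.

Lemma left_element_conj u v : u < v -> exists h q, [/\ u < q < v,
  exists s, forall y, s < y -> a h y = y & greatest_lower (fixed a h) q].
Proof.
move=> uv; have [g [[r gr] [s gs]]] := left_element.
have [q [lb greatest]] : exists q, greatest_lower (fixed a g) q.
  apply: (@real_greatest_lower _ (fixed a g) (r + 1) s) => [|y gy].
    by apply: gr; rewrite ltrDl.
  by rewrite leNgt; apply/negP => /gs.
have [h hq] := orbit_dense q uv.
exists (g ^ h)%g, (a h q); split=> //.
  exists (a h r) => y; rewrite -[y](actVK a h) act_lt => /gr gy.
  by rewrite act_conj gy.
have E y : fixed a (g ^ h)%g (a h y) <-> fixed a g y.
  by rewrite /fixed act_conj; split=> [/act_inj|->].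
split=> [y|z zlb].
  by rewrite -[y](actVK a h) E act_le; exact: lb.
rewrite -act_leV; apply: greatest => y /E/zlb.
by rewrite -act_leV.
Qed.

(** Put the first fixed point [q'] of a left element in ]u, v[ and the last
    fixed point [q] of a right element below [q'].  The stabiliser of [q] moves
    every point above [q], so it brings [y] below [q']; the stabiliser of [q']
    moves every point below [q'], so it then brings the image of [x] above [u]
    while the image of [y] stays below [q']. *)
Lemma proximal x y u v : u < v -> exists w, u < a w x /\ a w y < v.
Proof.
move=> uv; have [h [q' [/andP[uq' q'v] _ glb]]] := left_element_conj uv.
have [g [q [qq' _ lub]]] := right_element_conj q'.
have gq : fixed a g q.
  exact: least_upper_fixed (centraliser_subgroup g) (@fixed_stable _ _ _ g) lub _ _.
have hq' : fixed a h q'.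
  exact: greatest_lower_fixed (centraliser_subgroup h) (@fixed_stable _ _ _ h) glb _ _.
have [|f1 f1q f1y] :=
  orbit_unbounded_below (a := a) (u := q') y (point_stabiliser_subgroup a q).
  move=> z q'z; exists g => // /lub.1 /(le_trans q'z).
  by rewrite leNgt qq'.
have [|f2 f2q f2x] :=
  orbit_unbounded_above (a := a) (u := u) (a f1 x)
    (point_stabiliser_subgroup a q').
  move=> z zu; exists h => // /glb.1 q'z.
  by have := le_trans q'z zu; rewrite leNgt uq'.
exists (f1 * f2)%g; rewrite !actM; split=> //.
by apply: lt_trans q'v; rewrite -f2q act_lt.
Qed.

(** The commutator of a right element [g] and a left element [h] has trivial
    germs at both ends.  If they commuted, [g] would preserve the fixed points
    of [h], hence fix the first of them, [q'], which lies beyond the last fixed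
    point [q] of [g]. *)
Lemma compact_nontrivial : exists2 k, compactly_supported a k & k <> 1%g.
Proof.
have [|h [q' [_ [s hs] glb]]] := @left_element_conj 0 1; first exact: ltr01.
have [g [q [qq' [r gr] lub]]] := right_element_conj q'.
exists [~ g, h]%g.
  exists (Num.min r (a h r) - 1), (Num.max s (a g s) + 1) => y [].
    rewrite lerBrDr le_min => /andP[yr yhr].
    apply: commutator_fix; first by apply: gr; lra.
    by apply: gr; rewrite act_ltV; lra.
  rewrite -lerBrDr ge_max => /andP[sy gsy].
  have hy : a h y = y by apply: hs; lra.
  have hgy : a h (a g^-1%g y) = a g^-1%g y by apply: hs; rewrite act_gtV; lra.
  rewrite -invgR; apply: act_fixV; exact: commutator_fix.
move=> /eqP/commgP gh.
have := greatest_lower_fixed (centraliser_subgroup h) (@fixed_stable _ _ _ h) glb.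
move=> /(_ _ (commute_sym gh)) /lub.1.
by rewrite leNgt qq'.
Qed.

(** Some element of [N] moves all points of an open interval, and density of
    orbits brings [z] into this interval. *)
Lemma normal_moves (N : Gt -> Prop) k : (forall g h, N g -> N (g ^ h)%g) ->
  N k -> k <> 1%g -> forall z, exists2 g, N g & a g z <> z.
Proof.
move=> NJ Nk /(nontrivial_moves a_inj) [y ky] z.
pose u := Num.min y (a k y); pose v := Num.max y (a k y).
have moved x : u < x < v -> a k x <> x.
  rewrite /u /v gt_min lt_max => xuv kx.
  have := act_lt a k y x; have := act_lt a k x y; rewrite kx.
  by move: ky xuv => /eqP; rewrite neq_lt; lra.
have uv : u < v.
  by move/eqP: ky; rewrite /u /v neq_lt gt_min !lt_max !ltxx orbF /= orbC.
have [g /moved kg] := orbit_dense z uv.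
exists (k ^ g^-1)%g; first exact: NJ.
rewrite -{1}(actK a g z) act_conj => /(congr1 (a g)).
by rewrite actVK.
Qed.

Lemma compactly_supported_moves z :
  exists2 k, compactly_supported a k & a k z <> z.
Proof.
have [k ks k1] := compact_nontrivial.
apply: (normal_moves _ ks k1) => g h [p [q gs]].
by exists (a h p), (a h q); exact: supported_inJ.
Qed.

(** Take [k] compactly supported and the least [m] such that [k] is the
    identity on [m, +oo[.  Everything commuting with [k] fixes [m], yet some
    compactly supported element moves [m]. *)
Lemma compact_noncommuting : exists f g,
  [/\ compactly_supported a f, compactly_supported a g & [~ f, g]%g <> 1%g].
Proof.
apply: contrapT => abel.
have {}abel f g : compactly_supported a f -> compactly_supported a g ->
    commute f g.
  move=> fs gs; apply/commgP/eqP; apply: contrapT => fg.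
  by apply: abel; exists f, g.
have [k ks k1] := compact_nontrivial.
have [p [q kpq]] := ks.
have [y0 ky0] := nontrivial_moves a_inj k1.
pose S y := forall z, y <= z -> a k z = z.
have [m glb] : exists m, greatest_lower S m.
  apply: (@real_greatest_lower _ S q y0) => [z qz|y Sy].
    by apply: kpq; right.
  by rewrite leNgt; apply/negP => /ltW/Sy.
have [g gs] := compactly_supported_moves m; apply.
apply: (greatest_lower_fixed (centraliser_subgroup k) _ glb); last exact: abel.
move=> h y kh Sy z; rewrite -act_geV => /Sy kz.
rewrite -[z](actVK a h) (act_commute _ _ kh) kz //.
Qed.

Lemma local_commutator_nontrivial :
  exists p q k, local_commutator a p q k /\ k <> 1%g.
Proof.
have [f [g [[p [q fs]] [p' [q' gs]] fg]]] := compact_noncommuting.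
exists (Num.min p p'), (Num.max q q'), [~ f, g]%g; split=> //.
exists f, g; split=> // y.
  by rewrite le_min ge_max => -[/andP[yp _]|/andP[qy _]]; apply: fs; [left|right].
by rewrite le_min ge_max => -[/andP[_ yp]|/andP[_ qy]]; apply: gs; [left|right].
Qed.

Lemma local_commutator_moves z :
  exists p q k, local_commutator a p q k /\ a k z <> z.
Proof.
have [p [q [k [kc k1]]]] := local_commutator_nontrivial.
pose N k := exists p q, local_commutator a p q k.
have [||k' [p' [q' kc']] kz] := @normal_moves N k _ _ k1 z.
- by move=> g h [p' [q' gc]]; exists (a h p'), (a h q'); exact: local_commutatorJ.
- by exists p, q.
by exists p', q', k'.
Qed.

(** A commutator moving [z] may be supported in an interval that reaches to
    the left of [c].  Conjugating it by elements that are the identity on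
    [z, +oo[ and push the support to the right of [c] does not affect what
    happens at [z]. *)
Lemma local_commutator_moves_right c z : c < z -> exists p q k,
  [/\ c < p, local_commutator a p q k & a k z <> z].
Proof.
move=> cz; have [p [q [k [kc kz]]]] := local_commutator_moves z.
have [|h [q' [_ [s hs] glb]]] := @left_element_conj 0 1; first exact: ltr01.
have [w [cw wz]] := proximal q' (s + 1) cz.
pose D f := forall y, z <= y -> a f y = y.
have [|f fD pf] :=
  orbit_unbounded_above (a := a) (u := c) p
    (fixing_subgroup a (fun y => z <= y)).
  move=> x xc; exists (h ^ w)%g => [y zy|].
    rewrite -[y](actVK a w) act_conj hs // act_gtV.
    by apply: lt_le_trans zy; apply: lt_trans wz; rewrite act_lt ltrDl.
  move: xc; rewrite -[x](actVK a w) act_conj; set y := a w^-1%g x.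
  move=> yc /act_inj/glb.1; rewrite -(act_le a w) leNgt.
  by rewrite (le_lt_trans yc).
exists (a f p), (a f q), (k ^ f)%g; split=> //; first exact: local_commutatorJ.
rewrite -{1}(fD z) // act_conj => E; apply: kz.
by apply: (@act_inj _ _ _ a f); rewrite E fD.
Qed.

Lemma local_commutator_left x :
  exists p q k, [/\ q < x, local_commutator a p q k & k <> 1%g].
Proof.
have [p [q [k [kc k1]]]] := local_commutator_nontrivial.
have [|w [_ qw]] := @proximal q q (x - 1) x; first by rewrite ltrBlDr ltrDl.
exists (a w p), (a w q), (k ^ w)%g; split=> //; first exact: local_commutatorJ.
by move/eqP; rewrite conjg_eq1 => /eqP.
Qed.

Lemma local_commutator_right x :
  exists p q k, [/\ x < p, local_commutator a p q k & k <> 1%g].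
Proof.
have [p [q [k [kc k1]]]] := local_commutator_nontrivial.
have [|w [pw _]] := @proximal p p x (x + 1); first by rewrite ltrDl.
exists (a w p), (a w q), (k ^ w)%g; split=> //; first exact: local_commutatorJ.
by move/eqP; rewrite conjg_eq1 => /eqP.
Qed.

End Coherent.

(** * One-sided slopes of piecewise linear homeomorphisms *)
Section PiecewiseLinear.
Local Open Scope ring_scope.
Context {R : realType}.
Local Notation I := (unit_interval R).
Implicit Types (f g h : homeo I) (p q x y c : I) (b : bool) (k l : int).

Lemma unit_le x y : (x <= y) = (val x <= val y).
Proof. by []. Qed.

Lemma unit_lt x y : (x < y) = (val x < val y).
Proof. by rewrite !ltNge unit_le. Qed.

Lemma unit_interval_le1 x : val x <= 1.
Proof. by case: x => x /= /set_mem /=; rewrite in_itv /= => /andP[]. Qed.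

Lemma unit_point (t : R) : 0 <= t <= 1 -> exists x : I, val x = t.
Proof.
move=> t01; have tP : t \in (`[0, 1]%classic : set R).
  by apply/mem_set; rewrite /= in_itv.
by exists (exist _ t tP).
Qed.

Lemma unit_least_upper (S : I -> Prop) x : S x -> exists m, least_upper S m.
Proof.
move=> Sx; pose V (t : R) := exists2 y, S y & t = val y.
have [|t [y _ ->]|m [ub least]] := @real_least_upper _ V (val x) 1.
- by exists x.
- exact: unit_interval_le1.
have [|z zm] := @unit_point m.
  rewrite least ?andbT; last by move=> t [y _ ->]; exact: unit_interval_le1.
  by apply: le_trans (unit_interval_ge0 x) _; apply: ub; exists x.
exists z; split=> [y Sy|w wub]; rewrite unit_le zm; first by apply: ub; exists y.
by apply: least => t [y Sy ->]; rewrite -unit_le wub.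
Qed.

Lemma unit_greatest_lower (S : I -> Prop) x :
  S x -> exists m, greatest_lower S m.
Proof.
move=> Sx; pose V (t : R) := exists2 y, S y & t = val y.
have [|t [y _ ->]|m [lb greatest]] := @real_greatest_lower _ V (val x) 0.
- by exists x.
- exact: unit_interval_ge0.
have [|z zm] := @unit_point m.
  rewrite greatest /=; last by move=> t [y _ ->]; exact: unit_interval_ge0.
  by apply: le_trans (unit_interval_le1 x); apply: lb; exists x.
exists z; split=> [y Sy|w wlb]; rewrite unit_le zm; first by apply: lb; exists y.
by apply: greatest => t [y Sy ->]; rewrite -unit_le wlb.
Qed.

Lemma least_upper_approx (S : I -> Prop) x m (e : R) : S x ->
  least_upper S m -> 0 < e -> exists2 y, S y & 0 <= val m - val y < e.
Proof.
move=> Sx [ub least] e0; apply: contrapT => no.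
have far y : S y -> val y <= val m - e.
  move=> Sy; rewrite leNgt; apply/negP => cy; apply: no; exists y => //.
  by have := ub _ Sy; rewrite unit_le; lra.
have [|z zm] := @unit_point (val m - e).
  by have := unit_interval_le1 m; have := far _ Sx; have := unit_interval_ge0 x; lra.
have /least : forall y, S y -> y <= z by move=> y /far; rewrite unit_le zm.
by rewrite unit_le zm; lra.
Qed.

Lemma greatest_lower_approx (S : I -> Prop) x m (e : R) : S x ->
  greatest_lower S m -> 0 < e -> exists2 y, S y & 0 <= val y - val m < e.
Proof.
move=> Sx [lb greatest] e0; apply: contrapT => no.
have far y : S y -> val m + e <= val y.
  move=> Sy; rewrite leNgt; apply/negP => cy; apply: no; exists y => //.
  by have := lb _ Sy; rewrite unit_le; lra.
have [|z zm] := @unit_point (val m + e).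
  by have := unit_interval_ge0 m; have := far _ Sx; have := unit_interval_le1 x; lra.
have /greatest : forall y, S y -> z <= y by move=> y /far; rewrite unit_le zm.
by rewrite unit_le zm; lra.
Qed.

Definition orientation b : R := (-1) ^+ b.

(** [b] is [true] for the left side of [p] and [false] for the right side.
    At an end of the interval one of the two sides is empty, and every integer
    is then a slope; so slopes are a relation and not a function. *)
Definition germ_slope b p f k := exists2 e : R, 0 < e &
  forall y, 0 <= orientation b * (val y - val p) < e ->
    val (f y) - val p = 2 ^ k * (val y - val p).

Lemma exp2_gt0 k : 0 < (2 : R) ^ k.
Proof. by rewrite exprz_gt0. Qed.

Lemma germ_slope_fix b p f k : germ_slope b p f k -> f p = p.
Proof.
move=> [e e0 fp]; apply/val_inj/eqP; rewrite -subr_eq0 fp ?subrr ?mulr0 //.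
by rewrite lexx.
Qed.

Lemma germ_slopeM b p f g k l : germ_slope b p f k -> germ_slope b p g l ->
  germ_slope b p (f * g)%g (k + l).
Proof.
move=> [e e0 fe] [e' e'0 ge']; have K := exp2_gt0 k.
exists (Num.min e (e' / 2 ^ k)); first by rewrite lt_min e0 divr_gt0.
move=> y; rewrite lt_min => /and3P[y0 ye]; rewrite ltr_pdivlMr // mulrC => ye'.
have fy : val (f y) - val p = 2 ^ k * (val y - val p) by rewrite fe ?y0.
rewrite [LHS]ge'; first by rewrite fy expfzDr ?pnatr_eq0 // mulrA [2 ^ l * _]mulrC.
by rewrite fy mulrCA ye' mulr_ge0 // ltW.
Qed.

(** The inverse image [z] of a point close to [p] is close to [p]: otherwise
    the point [w] at distance [e / 2] lies between [p] and [z], and its image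
    is known. *)
Lemma germ_slopeV b p f k : germ_slope b p f k -> germ_slope b p f^-1%g (- k).
Proof.
move=> [e e0 fe]; have K := exp2_gt0 k.
have fp : f p = p by apply: (@germ_slope_fix b p f k); exists e.
exists (2 ^ k * (e / 2)) => [|y]; first by rewrite mulr_gt0 ?divr_gt0.
set z : I := (f^-1)%g y; have -> : y = f z by rewrite /z homeo_invK.
move=> /andP[fz0 fze].
suff ze : 0 <= orientation b * (val z - val p) < e.
  by rewrite fe // mulrA -expfzDr ?pnatr_eq0 // addNr mul1r.
have mono q : 0 <= orientation b * (val (f z) - val (f q)) =
    (0 <= orientation b * (val z - val q)).
  rewrite /orientation; case: (b); rewrite ?expr1 ?expr0 ?mulN1r ?mul1r ?opprB subr_ge0.
    by rewrite subr_ge0 -!unit_le homeo_mono.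
  by rewrite subr_ge0 -!unit_le homeo_mono.
have z0 : 0 <= orientation b * (val z - val p) by rewrite -mono fp.
rewrite z0 ltNge; apply/negP => ez.
have sb : orientation b * orientation b = 1 by rewrite -expr2 sqrr_sign.
have [|w wE] := @unit_point (val p + orientation b * (e / 2)).
  have := unit_interval_ge0 p; have := unit_interval_ge0 z.
  have := unit_interval_le1 p; have := unit_interval_le1 z.
  by move: ez; rewrite /orientation; case: (b); rewrite ?expr1 ?expr0; lra.
have wp : val w - val p = orientation b * (e / 2) by rewrite wE addrC addKr.
have : 0 <= orientation b * (val z - val w).
  have -> : val z - val w = (val z - val p) - (val w - val p) by ring.
  by rewrite mulrBr wp (mulrA (orientation b) (orientation b)) sb mul1r; lra.
rewrite -mono; have -> : val (f z) - val (f w) =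
  (val (f z) - val p) - (val (f w) - val p) by ring.
rewrite (fe w); last by rewrite wp (mulrA (orientation b) (orientation b)) sb mul1r; lra.
rewrite wp mulrBr mulrCA (mulrA (orientation b) (orientation b)) sb mul1r subr_ge0 leNgt.
by rewrite fze.
Qed.

Lemma breakpoint_free_right (s : seq I) p : val p < 1 ->
  exists2 q, p < q & forall c, c \in s -> ~~ (p < c < q).
Proof.
move=> p1; elim: s => [|c s [q pq IHs]].
  have [|q q1] := @unit_point 1; first by rewrite ler01 lexx.
  by exists q => //; rewrite unit_lt q1.
have [/andP[pc cq]|pcq] := boolP (p < c < q).
  exists c => // d; rewrite inE => /predU1P[->|/IHs]; first by rewrite ltxx andbF.
  by apply: contra => /andP[-> /lt_trans]; apply.
by exists q => // d; rewrite inE => /predU1P[->|/IHs].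
Qed.

Lemma breakpoint_free_left (s : seq I) p : 0 < val p ->
  exists2 q, q < p & forall c, c \in s -> ~~ (q < c < p).
Proof.
move=> p0; elim: s => [|c s [q qp IHs]].
  by exists (unit_interval_0 R) => //; rewrite unit_lt.
have [/andP[qc cp]|qcp] := boolP (q < c < p).
  exists c => // d; rewrite inE => /predU1P[->|/IHs]; first by rewrite ltxx.
  by apply: contra => /andP[cd ->]; rewrite (lt_trans qc).
by exists q => // d; rewrite inE => /predU1P[->|/IHs].
Qed.

Lemma thompson_germ_slope b p f :
  thompson_map f -> f p = p -> exists k, germ_slope b p f k.
Proof.
move=> [s _ fs] fp; case: b.
  have := unit_interval_ge0 p; rewrite le_eqVlt => /predU1P[p0|p0].
    exists 0, 1 => // y; rewrite /orientation expr1 => /andP[y0 _].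
    have -> : y = p by apply/val_inj; have := unit_interval_ge0 y; lra.
    by rewrite fp subrr mulr0.
  have [q qp /fs [k [t kt]]] := breakpoint_free_left s p0.
  exists k, (val p - val q); first by rewrite subr_gt0 -unit_lt.
  move=> y; rewrite /orientation expr1 => /andP[yp qy].
  have kp : val p = 2 ^ k * val p + t by rewrite -{1}fp kt // lexx andbT ltW.
  rewrite kt; first by rewrite {1}kp mulrBr opprD addrACA subrr addr0.
  by rewrite !unit_le; lra.
have := unit_interval_le1 p; rewrite le_eqVlt => /predU1P[p1|p1].
  exists 0, 1 => // y; rewrite /orientation expr0 => /andP[y0 _].
  have -> : y = p by apply/val_inj; have := unit_interval_le1 y; lra.
  by rewrite fp subrr mulr0.
have [q pq /fs [k [t kt]]] := breakpoint_free_right s p1.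
exists k, (val q - val p); first by rewrite subr_gt0 -unit_lt.
move=> y; rewrite /orientation expr0 => /andP[yp yq].
have kp : val p = 2 ^ k * val p + t by rewrite -{1}fp kt // lexx ltW.
rewrite kt; first by rewrite {1}kp mulrBr opprD addrACA subrr addr0.
by rewrite !unit_le; lra.
Qed.

(** A linear germ with a fixed point other than [p] has slope 1. *)
Lemma germ_dichotomy b p f k : germ_slope b p f k ->
  exists2 e : R, 0 < e &
    (forall y, 0 <= orientation b * (val y - val p) < e -> f y = y) \/
    (forall y, 0 <= orientation b * (val y - val p) < e -> f y = y -> y = p).
Proof.
move=> [e e0 fe]; exists e => //; have [k1|k1] := eqVneq ((2 : R) ^ k) 1.
  left=> y /fe; rewrite k1 mul1r => /addIr.
  exact: val_inj.
right=> y /fe fy yy; move: fy; rewrite yy => E; apply/val_inj/eqP.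
have /eqP : (1 - 2 ^ k) * (val y - val p) = 0 by rewrite mulrBl mul1r -E subrr.
by rewrite mulf_eq0 !subr_eq0 eq_sym (negPf k1).
Qed.

Lemma germ_slope0 b p f : germ_slope b p f 0 -> exists2 e : R, 0 < e &
  forall y, 0 <= orientation b * (val y - val p) < e -> f y = y.
Proof.
move=> [e e0 fe]; exists e => // y /fe; rewrite mul1r => /addIr; exact: val_inj.
Qed.

End PiecewiseLinear.

(** * Commuting elements of Thompson's group *)
Section CommutingElements.
Local Open Scope ring_scope.
Context {R : realType}.
Local Notation I := (unit_interval R).
Implicit Types (f g h : homeo I) (p q e x y c : I).

Lemma component_left_end h p : h p <> p ->
  exists2 e, e < p & h e = e /\ forall y, e < y <= p -> h y <> y.
Proof.
move=> hp; pose S y := y <= p /\ h y = y.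
have S0 : S (unit_interval_0 R).
  by split; [exact: unit_interval_0_le|exact: homeo_unit_0].
have [e lub] := unit_least_upper S0.
have ep : e <= p by apply: lub.2 => y [].
have he : h e = e.
  pose a : {multiplicative homeo I -> homeo I} := idfun.
  have inv : stable_under a (fun g => forall y, S y -> a g y = y) S.
    by move=> g y gS Sy; rewrite gS.
  apply: (least_upper_fixed (a := a) (fixing_subgroup a S) inv lub (g := h)).
  by move=> y [].
exists e.
  by rewrite lt_neqAle ep andbT; apply/eqP => epE; apply: hp; rewrite -epE.
split=> // y /andP[ey yp] hy.
by have := lub.1 y (conj yp hy); rewrite leNgt ey.
Qed.

(** Let [m] be the supremum of the images of [e] under the centraliser of [h].
    It is fixed by this centraliser.  If [e < m], these images are fixed points
    of [h] accumulating at [m] from the left, so [h], being linear there, is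
    the identity on an interval ending at [m].  An element of the centraliser
    that maps [e] into this interval maps all of [[e, m]] into it, so [h] is
    the identity on [[e, m]] too, while it has no fixed point just above [e].
    So [e = m]. *)
Lemma commuting_fixes_end f h e p : thompson_map h -> e < p -> h e = e ->
  (forall y, e < y <= p -> h y <> y) -> commute h f -> f e = e.
Proof.
move=> hF ep he hfree hf; pose a : {multiplicative homeo I -> homeo I} := idfun.
have Dgrp := centraliser_subgroup h.
have Se := orbit_refl a e Dgrp.
have [m lub] := unit_least_upper Se.
have mfix g : commute h g -> g m = m.
  exact: (least_upper_fixed Dgrp (orbit_stable Dgrp) lub).
have [em|/eqP em] := eqVneq e m; first by rewrite em mfix.
have em' : e < m by rewrite lt_neqAle (introN eqP em) lub.1.
have [k hk] := thompson_germ_slope true hF (mfix _ (commute_refl h)).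
have [r r0 hr] := germ_dichotomy hk.
have [_ [g gh ->] gm] := least_upper_approx Se lub r0.
have hge : h (a g e) = a g e by exact: etrans (act_commute a e gh) (congr1 g he).
have near z : a g e <= z <= m -> 0 <= orientation true * (val z - val m) < r.
  by rewrite /orientation expr1 !unit_le => /andP[gz zm]; lra.
have gm' : a g m = m by exact: mfix.
case: hr => hr; last first.
  have /(hr _) : 0 <= orientation true * (val (a g e) - val m) < r.
    by apply: near; rewrite lexx lub.1 //; exists g.
  by move=> /(_ hge) gem; case: em; apply: (@act_inj _ _ _ a g); rewrite gem gm'.
exfalso; pose z := Order.min p m.
have ez : e < z by rewrite lt_min ep.
apply: (hfree z); first by rewrite ez ge_min lexx.
apply: (@act_inj _ _ _ a g); apply: etrans (esym (act_commute a z gh)) _.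
apply: hr; apply: near; apply/andP; split; first by rewrite act_le ltW.
by rewrite -[leRHS]gm' act_le ge_min lexx orbT.
Qed.

(** As [h] has no fixed point in ]e, p], the elements that commute with [s] and
    fix [e], among which is [h], bring [p] arbitrarily close to [e], where [s]
    is the identity. *)
Lemma trivial_on_component s h e p (r : R) : e < p -> h e = e ->
  (forall y, e < y <= p -> h y <> y) -> commute s h ->
  0 < r -> (forall y, 0 <= val y - val e < r -> s y = y) -> s p = p.
Proof.
move=> ep he hfree sh r0 sr; pose a : {multiplicative homeo I -> homeo I} := idfun.
pose D g := commute s g /\ a g e = e.
have Dgrp : subgroup_pred D.
  have [C1 CM CV] := centraliser_subgroup s.
  have [E1 EM EV] := point_stabiliser_subgroup a e.
  split=> [//|g k [gs ge] [ks ke]|g [gs ge]].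
    by split; [exact: CM|exact: EM].
  by split; [exact: CV|exact: EV].
have Sp := orbit_refl a p Dgrp.
have [m glb] := unit_greatest_lower Sp.
have em : e <= m.
  by apply: glb.2 => _ [g [_ ge] ->]; rewrite -ge act_le ltW.
have hm : h m = m.
  apply: (greatest_lower_fixed Dgrp (orbit_stable Dgrp) glb).
  by split.
have mE : m = e.
  apply/eqP; move: em; rewrite le_eqVlt eq_sym => /predU1P[->//|em].
  by case: (hfree m); rewrite ?em ?glb.1.
rewrite mE in glb.
have [_ [g [gs _] ->] /sr ge] := greatest_lower_approx Sp glb r0.
by apply: (@act_inj _ _ _ a g); apply: etrans (esym (act_commute a p gs)) _.
Qed.

(** Let [e] be the left end of the component of the support of [h] containing
    [p].  Both [f] and [g] fix [e] and have linear germs there, which commute.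
    So the commutator is trivial near [e], hence on the component. *)
Lemma commutator_of_commuting_fixes f g h p :
  thompson_map f -> thompson_map g -> thompson_map h ->
  commute f h -> commute g h -> h p <> p -> [~ f, g]%g p = p.
Proof.
move=> fF gF hF fh gh hp.
have [e ep [he hfree]] := component_left_end hp.
have fe := commuting_fixes_end hF ep he hfree (commute_sym fh).
have ge := commuting_fixes_end hF ep he hfree (commute_sym gh).
have [k fk] := thompson_germ_slope false fF fe.
have [l gl] := thompson_germ_slope false gF ge.
have : germ_slope false e [~ f, g]%g (- k + (- l + (k + l))).
  rewrite commgEl conjgE.
  by do ![apply: germ_slopeM|apply: germ_slopeV|assumption].
rewrite (addrCA (- l)) addNr addr0 addNr => /germ_slope0 [r r0 sr].
apply: (trivial_on_component ep he hfree _ r0) => [|y yr].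
  apply/commute_sym; rewrite commgEl conjgE.
  by do ![apply: commuteM|apply: commuteV|exact: commute_sym].
by apply: sr; rewrite /orientation expr0 mul1r.
Qed.

End CommutingElements.

(** * A strictly monotone equivariant map from the line to the interval *)
Section TwoActions.
Local Open Scope ring_scope.
Context {R : realType} {Gt : groupType}.
Local Notation I := (unit_interval R).
Variables (a : {multiplicative Gt -> homeo R}) (b : {multiplicative Gt -> homeo I}).
Hypotheses (a_inj : injective a) (b_inj : injective b).
Hypothesis orbit_dense : forall x u v, u < v -> exists g, u < a g x < v.
Hypothesis right_element : exists g, (exists r, forall y, y < r -> a g y = y) /\
  (exists r, forall y, r < y -> a g y <> y).
Hypothesis left_element : exists h, (exists s, forall y, s < y -> a h y = y) /\
  (exists s, forall y, y < s -> a h y <> y).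
Hypothesis b_thompson : forall g, thompson_map (b g).
Implicit Types (f g h k : Gt) (x z p q : R) (y c m : I) (K : Gt -> Prop).

Definition commutator_left x k := exists p q, q < x /\ local_commutator a p q k.
Definition commutator_right x k := exists p q, x < p /\ local_commutator a p q k.
Definition commutator_any k := exists p q, local_commutator a p q k.

Definition moved K y := exists2 k, K k & b k y <> y.

Local Notation U x := (moved (commutator_left x)).
Local Notation V x := (moved (commutator_right x)).

Lemma movedJ K K' g y : (forall k, K k -> K' (k ^ g)%g) ->
  moved K y -> moved K' (b g y).
Proof.
move=> KK' [k /KK' Kk ky]; exists (k ^ g)%g => //.
by rewrite act_conj => /act_inj.
Qed.

Lemma moved_leftJ x g y : U x y -> U (a g x) (b g y).
Proof.
apply: movedJ => k [p [q [qx kc]]]; exists (a g p), (a g q).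
by rewrite act_lt; split=> //; exact: local_commutatorJ.
Qed.

Lemma moved_rightJ x g y : V x y -> V (a g x) (b g y).
Proof.
apply: movedJ => k [p [q [qx kc]]]; exists (a g p), (a g q).
by rewrite act_lt; split=> //; exact: local_commutatorJ.
Qed.

Lemma moved_left_le x z y : x <= z -> U x y -> U z y.
Proof.
move=> xz [k [p [q [qx kc]]] ky]; exists k => //.
by exists p, q; rewrite (lt_le_trans qx).
Qed.

Lemma moved_right_ge x z y : x <= z -> V z y -> V x y.
Proof.
move=> xz [k [p [q [qx kc]]] ky]; exists k => //.
by exists p, q; rewrite (le_lt_trans xz).
Qed.

Lemma moved_any_left y : moved commutator_any y -> exists x, U x y.
Proof.
move=> [k [p [q kc]] ky]; exists (q + 1), k => //.
by exists p, q; rewrite ltrDl.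
Qed.

Lemma moved_any_right y : moved commutator_any y -> exists x, V x y.
Proof.
move=> [k [p [q kc]] ky]; exists (p - 1), k => //.
by exists p, q; rewrite ltrBDr ltrDl.
Qed.

Lemma moved_left_any x y : U x y -> moved commutator_any y.
Proof. by move=> [k [p [q [_ kc]]] ky]; exists k => //; exists p, q. Qed.

Lemma moved_right_any x y : V x y -> moved commutator_any y.
Proof. by move=> [k [p [q [_ kc]]] ky]; exists k => //; exists p, q. Qed.

Lemma moved_disjoint x y : U x y -> V x y -> False.
Proof.
move=> [k [p [q [qx [f [g [fs gs kE]]]]]] ky] [k' [p' [q' [xp kc']]] ky'].
have ks' := local_commutator_supported kc'.
have qp' : q <= p' by apply/ltW/(lt_trans qx).
apply: ky; rewrite kE act_commutator.
apply: commutator_of_commuting_fixes (b_thompson _) (b_thompson _)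
  (b_thompson k') _ _ ky'.
- by apply: gmulf_commute; exact: supported_in_commute fs ks' qp'.
- by apply: gmulf_commute; exact: supported_in_commute gs ks' qp'.
Qed.

(** If [y] is not in [V x], the stabiliser of [y] contains all commutators
    supported to the right of [x].  These move every point of the line beyond
    [x], so elements of the stabiliser push any compact interval to the left of
    [z]; conjugating by them turns a commutator that moves [y] into one that
    moves [y] and is supported to the left of [z]. *)
Lemma moved_overlap x z y : x < z ->
  moved commutator_any y -> U z y \/ V x y.
Proof.
move=> xz [k [p [q kc]] ky].
have [|nV] := pselect (V x y); [by right|left].
have [|f fy fq] :=
  orbit_unbounded_below (a := a) (u := z) q (point_stabiliser_subgroup b y).
  move=> t zt; have xt := lt_le_trans xz zt.
  have [p' [q' [k' [xp' kc' kt']]]] :=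
    local_commutator_moves_right a_inj orbit_dense right_element left_element xt.
  exists k' => //; apply: contrapT => ky'; apply: nV; exists k' => //.
  by exists p', q'.
rewrite -fy; exists (k ^ f)%g; last by rewrite act_conj => /act_inj.
by exists (a f p), (a f q); split; last exact: local_commutatorJ.
Qed.

(** If [y] were outside [U x] and [V x], then also outside the sets for the
    image of [x] under [k], as [k] fixes [y]; and one of the two points is to
    the left of the other. *)
Lemma moved_dichotomy k x y : b k y = y -> a k x <> x ->
  moved commutator_any y -> U x y \/ V x y.
Proof.
move=> ky kx /moved_overlap ov; have [|nU] := pselect (U x y); [by left|right].
have [|nV] := pselect (V x y) => //.
have [xk|kx'|kx'] := ltgtP x (a k x); last by case: kx.
  have [Uk|//] := ov _ _ xk; case: nU.
  by rewrite -(actK a k x) -(act_fixV ky); exact: moved_leftJ.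
have [//|Vk] := ov _ _ kx'; case: nV.
by rewrite -(actK a k x) -(act_fixV ky); exact: moved_rightJ.
Qed.

(** Connectedness of the segment [[y, y']]: two disjoint open sets containing
    its two ends do not cover it.  Openness is used in the form that if [k]
    moves [m] up, then it moves all points between the inverse image and the
    image of [m]. *)
Lemma moved_gap K K' y y' :
  (forall k, K k -> K k^-1%g) -> (forall k, K' k -> K' k^-1%g) ->
  (forall z : I, moved K z -> moved K' z -> False) ->
  y < y' -> moved K y -> moved K' y' ->
  exists2 m, y <= m <= y' & ~ moved K m /\ ~ moved K' m.
Proof.
have raise L (m : I) : (forall k, L k -> L k^-1%g) -> moved L m ->
    exists2 k, L k & m < b k m.
  move=> LV [k Lk /eqP]; rewrite neq_lt => /orP[km|mk]; last by exists k.
  by exists k^-1%g; [exact: LV|rewrite act_gtV].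
have between L k (z m : I) : L k -> m < b k m -> b k^-1%g m < z < b k m -> moved L z.
  move=> Lk mk /andP[]; rewrite act_ltV => mz zk; exists k => // kz.
  have [zm|mz'] := leP z m.
    by move: mz; rewrite kz ltNge zm.
  by have := act_lt b k m z; rewrite mz' kz ltNge ltW.
move=> KV KV' disj yy' Ky Ky'.
have Sy : y <= y' /\ moved K y by split=> //; exact: ltW.
have [m lub] := @unit_least_upper _ (fun z : I => z <= y' /\ moved K z) y Sy.
have my' : m <= y' by apply: lub.2 => z [].
exists m; first by rewrite my' andbT; exact: lub.1.
split=> [/(raise _ _ KV) [k Kk mk]|/(raise _ _ KV') [k Kk mk]].
  have [ky'|y'k] := leP (b k m) y'.
    have /lub.1 : b k m <= y' /\ moved K (b k m).
      split=> //; exists k => // /act_inj km.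
      by move: mk; rewrite km ltxx.
    by rewrite leNgt mk.
  apply: (disj y' _ Ky'); apply: (between _ k _ m) => //.
  by rewrite y'k andbT act_ltV (lt_le_trans mk) // act_le.
have Sub (z : I) : z <= y' /\ moved K z -> z <= b k^-1%g m.
  move=> Sz; rewrite leNgt; apply/negP => kz; apply: (disj z Sz.2).
  apply: (between _ k _ m) => //; rewrite kz /=.
  by rewrite (le_lt_trans (lub.1 _ Sz)).
by have := lub.2 _ Sub; rewrite act_geV leNgt mk.
Qed.

Lemma commutator_leftV x k : commutator_left x k -> commutator_left x k^-1%g.
Proof. by move=> [p [q [qx /local_commutatorV]]]; exists p, q. Qed.

Lemma commutator_rightV x k : commutator_right x k -> commutator_right x k^-1%g.
Proof. by move=> [p [q [qx /local_commutatorV]]]; exists p, q. Qed.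

Lemma moved_left_nonempty x : exists y, U x y.
Proof.
have [p [q [k [qx kc /(nontrivial_moves b_inj) [y ky]]]]] :=
  local_commutator_left a_inj orbit_dense right_element left_element x.
by exists y, k => //; exists p, q.
Qed.

Lemma moved_right_nonempty x : exists y, V x y.
Proof.
have [p [q [k [qx kc /(nontrivial_moves b_inj) [y ky]]]]] :=
  local_commutator_right a_inj orbit_dense right_element left_element x.
by exists y, k => //; exists p, q.
Qed.

(** A gap is a point of the interval between [c] and [c + e] that is neither
    in [U 0] nor in [V 0]; the choice of [k] makes it a fixed point of all
    local commutators.  The point [p2] of [U 0] is chosen below a gap [m].  The
    element [f] fixes all gaps and maps [p2] into [V 0], because in the line it
    moves some [z] with [p2] in [V z] beyond 0.  The segment from [p2] to its
    image stays below [m], and the gap [t] that it contains prevents [f] from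
    carrying [p2] across. *)
Lemma no_common_infimum c : (forall g, b g c = c) ->
  (forall x, greatest_lower (fun y => U x y) c) ->
  (forall x, greatest_lower (fun y => V x y) c) -> False.
Proof.
move=> c_fixed infU infV.
have moved_neq K y : moved K y -> y <> c by move=> [k _ ky] yc; apply: ky; rewrite yc.
have U_near x (e : R) : 0 < e -> exists2 y, U x y & 0 <= val y - val c < e.
  have [y0 Uy0] := moved_left_nonempty x.
  exact: greatest_lower_approx Uy0 (infU x).
have V_near x (e : R) : 0 < e -> exists2 y, V x y & 0 <= val y - val c < e.
  have [y0 Vy0] := moved_right_nonempty x.
  exact: greatest_lower_approx Vy0 (infV x).
have above K y : moved K y -> 0 <= val y - val c -> 0 < val y - val c.
  move=> /moved_neq yc; rewrite !subr_ge0 subr_gt0 -unit_le -unit_lt lt_neqAle.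
  by move=> ->; rewrite andbT; apply/eqP => cy; apply: yc.
have [p [q [k [kc k0]]]] :=
  local_commutator_moves a_inj orbit_dense right_element left_element 0.
have [n /germ_dichotomy [e e0 k_germ]] :=
  thompson_germ_slope false (b_thompson k) (c_fixed k).
(* If k moved all points close to c other than c, it would move some point of
   V (q + 1); as k is supported in [p, q], this point is also in U (q + 1). *)
have {}k_germ y : 0 <= val y - val c < e -> b k y = y.
  move: y; case: k_germ => k_germ y ye.
    by apply: k_germ; rewrite /orientation expr0 mul1r.
  have [y' Vy' y'e] := V_near (q + 1) _ e0.
  exfalso; apply: (moved_disjoint _ Vy'); exists k.
    by exists p, q; rewrite ltrDl.
  move=> ky'; apply: (moved_neq _ _ Vy').
  by apply: k_germ ky'; rewrite /orientation expr0 mul1r.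
have gap_fixed m : 0 <= val m - val c < e -> ~ U 0 m -> ~ V 0 m ->
    ~ moved commutator_any m.
  by move=> /k_germ km nU nV /(moved_dichotomy km k0) [].
have disj' y : V 0 y -> U 0 y -> False by move=> Vy Uy; exact: moved_disjoint Uy Vy.
(* c < p1 <= m <= p0 with m a gap, then c < p2 < m. *)
have [p0 Up0 /andP[cp0 p0e]] := U_near 0 _ e0.
have [p1 Vp1 /andP[cp1 p10]] := V_near 0 _ (above _ _ Up0 cp0).
have p1p0 : p1 < p0 by rewrite unit_lt; lra.
have [m /andP[p1m mp0] [nVm nUm]] :=
  moved_gap (@commutator_rightV 0) (@commutator_leftV 0) disj' p1p0 Vp1 Up0.
have cm : 0 < val m - val c.
  by have := above _ _ Vp1 cp1; move: p1m; rewrite unit_le; lra.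
have m_fixed : ~ moved commutator_any m.
  by apply: gap_fixed => //; move: mp0; rewrite unit_le; lra.
have [p2 Up2 /andP[cp2 p2m]] := U_near 0 _ cm.
have [z Vz] := moved_any_right (moved_left_any Up2).
pose fixes_gaps g := forall y, ~ moved commutator_any y -> b g y = y.
have [|f f_gaps fz] := orbit_unbounded_above (a := a) (u := 0) z
    (fixing_subgroup b (fun y => ~ moved commutator_any y)).
  move=> t _; have [p' [q' [k' [kc' kt']]]] :=
    local_commutator_moves a_inj orbit_dense right_element left_element t.
  exists k' => // y ny; apply: contrapT => ky; apply: ny; exists k' => //.
  by exists p', q'.
have Vp3 : V 0 (b f p2) := moved_right_ge (ltW fz) (moved_rightJ f Vz).
have p3m : b f p2 < m.
  by rewrite -(f_gaps m m_fixed) act_lt unit_lt; lra.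
have cp3 : c <= b f p2 by rewrite -(c_fixed f) act_le unit_le; lra.
have fixed_below_m y : c <= y <= m -> ~ U 0 y -> ~ V 0 y -> b f y = y.
  move=> /andP[cy ym] nU nV; apply/f_gaps/gap_fixed => //.
  by move: cy ym mp0; rewrite !unit_le; lra.
have [p23|p32|p23] := ltgtP p2 (b f p2); last first.
- by apply: (disj' p2) => //; rewrite p23.
- have [t /andP[p3t tp2] [nVt nUt]] :=
    moved_gap (@commutator_rightV 0) (@commutator_leftV 0) disj' p32 Vp3 Up2.
  have ft : b f t = t.
    apply: fixed_below_m => //; rewrite (le_trans cp3) //=.
    by move: tp2; rewrite !unit_le; lra.
  apply: nVt; suff -> : t = b f p2 by [].
  by apply/le_anti; rewrite p3t andbT -{1}ft act_le.
- have [t /andP[p2t tp3] [nUt nVt]] :=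
    moved_gap (@commutator_leftV 0) (@commutator_rightV 0)
      (@moved_disjoint 0) p23 Up2 Vp3.
  have ft : b f t = t.
    apply: fixed_below_m => //; rewrite (le_trans tp3 (ltW p3m)) andbT.
    by move: p2t; rewrite !unit_le; lra.
  apply: nVt; suff -> : t = b f p2 by [].
  by apply/le_anti; rewrite tp3 /= -{1}ft act_le.
Qed.

Lemma greatest_lowerJ (S S' : I -> Prop) g c :
  (forall y, S y -> S' (b g y)) -> (forall y, S' y -> S (b g^-1%g y)) ->
  greatest_lower S c -> greatest_lower S' (b g c).
Proof.
move=> SS' S'S [lb greatest]; split=> [y /S'S/lb|z zlb]; first by rewrite act_geV.
by rewrite -act_leV; apply: greatest => y /SS'/zlb; rewrite act_leV.
Qed.

Lemma greatest_lower_unique (S : I -> Prop) c c' :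
  greatest_lower S c -> greatest_lower S c' -> c = c'.
Proof.
by move=> [lb gr] [lb' gr']; apply/le_anti; rewrite gr // gr'.
Qed.

Lemma infimum_equivariant (W : R -> I -> Prop) (s : R -> I) :
  (forall x g y, W x y -> W (a g x) (b g y)) ->
  (forall x, greatest_lower (W x) (s x)) ->
  forall g x, s (a g x) = b g (s x).
Proof.
move=> WJ sW g x; apply: greatest_lower_unique (sW _) _.
apply: greatest_lowerJ (sW x) => y; first exact: WJ.
by move=> /(WJ _ g^-1%g); rewrite actK.
Qed.

(** A monotone map constant on one segment is constant on all of them, since
    [proximal] maps any segment into the given one. *)
Lemma equivariant_constant (s : R -> I) x z :
  (forall g x, s (a g x) = b g (s x)) ->
  (forall x1 x2 x3, x1 <= x2 <= x3 -> s x1 = s x3 -> s x2 = s x1) ->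
  x < z -> s x = s z -> forall x' z', s x' = s z'.
Proof.
move=> sJ s_conv xz sxz.
suff ordered x' z' : x' <= z' -> s x' = s z'.
  by move=> x' z'; have [/ordered|/ltW/ordered] := leP x' z'.
move=> le; have [w [xw wz]] :=
  proximal orbit_dense right_element left_element x' z' xz.
have le' : a w x' <= a w z' by rewrite act_le.
apply: (@act_inj _ _ _ b w); rewrite -!sJ (s_conv x (a w x') z) //.
  by rewrite (s_conv x (a w z') z) // (le_trans (ltW xw)) // ltW.
by rewrite ltW //= (le_trans le') // ltW.
Qed.

Lemma equivariant_strictly_monotone : exists2 s : R -> I,
  (forall g x, s (a g x) = b g (s x)) &
  (forall x z, x < z -> s x < s z) \/ (forall x z, x < z -> s z < s x).
Proof.
have /choice [u uP] : forall x, exists c, greatest_lower (fun y => U x y) c.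
  by move=> x; have [y /unit_greatest_lower] := moved_left_nonempty x.
have /choice [v vP] : forall x, exists c, greatest_lower (fun y => V x y) c.
  by move=> x; have [y /unit_greatest_lower] := moved_right_nonempty x.
have uJ := infimum_equivariant moved_leftJ uP.
have vJ := infimum_equivariant moved_rightJ vP.
have u_le x z : x <= z -> u z <= u x.
  by move=> xz; apply: (uP x).2 => y /(moved_left_le xz)/(uP z).1.
have v_le x z : x <= z -> v x <= v z.
  by move=> xz; apply: (vP z).2 => y /(moved_right_ge xz)/(vP x).1.
have u_conv x1 x2 x3 : x1 <= x2 <= x3 -> u x1 = u x3 -> u x2 = u x1.
  move=> /andP[/u_le u12 /u_le u23] u13.
  by apply/le_anti; rewrite u12 u13 u23.
have v_conv x1 x2 x3 : x1 <= x2 <= x3 -> v x1 = v x3 -> v x2 = v x1.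
  move=> /andP[/v_le v12 /v_le v23] v13.
  by apply/le_anti; rewrite v12 v13 v23.
have [[x [z [xz uxz]]]|nu] := pselect (exists x z, x < z /\ u x = u z); last first.
  exists u => //; right=> x z xz; rewrite lt_neqAle u_le ?ltW // andbT.
  by apply/eqP => uxz; apply: nu; exists x, z.
have u_cst := equivariant_constant uJ u_conv xz uxz.
have [[x' [z' [xz' vxz]]]|nv] := pselect (exists x z, x < z /\ v x = v z); last first.
  exists v => //; left=> x' z' xz'; rewrite lt_neqAle v_le ?ltW // andbT.
  by apply/eqP => vxz; apply: nv; exists x', z'.
have v_cst := equivariant_constant vJ v_conv xz' vxz.
have uv : u 0 = v 0.
  apply/le_anti/andP; split.
    apply: (vP 0).2 => y /moved_right_any/moved_any_left [t /(uP t).1].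
    by rewrite (u_cst 0 t).
  apply: (uP 0).2 => y /moved_left_any/moved_any_right [t /(vP t).1].
  by rewrite (v_cst 0 t).
exfalso; apply: (@no_common_infimum (u 0)) => [g|t|t].
- by rewrite -uJ; exact: u_cst.
- by rewrite (u_cst 0 t); exact: uP.
- by rewrite uv (v_cst 0 t); exact: vP.
Qed.

End TwoActions.

(** * Groups with an integer slope have rank at most one *)
Section TensorRank.
Local Open Scope ring_scope.
Local Open Scope quotient_scope.
Context {M : zmodType}.
Local Notation T := (tensor_rat M).
Implicit Types (x y : M) (p q : rat) (t : T).

Definition pure_tensor x q : T := \pi_T [:: (x, q)].

Lemma pi_cat (s s' : seq (M * rat)) : \pi_T (s ++ s') = \pi_T s + \pi_T s' :> T.
Proof. by rewrite -tensor_addE. Qed.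

Lemma pure_tensorDl x y q :
  pure_tensor (x + y) q = pure_tensor x q + pure_tensor y q.
Proof. by rewrite -pi_cat; apply/tensor_piP; exact: tensor_Dl. Qed.

Lemma pure_tensorDr x p q :
  pure_tensor x (p + q) = pure_tensor x p + pure_tensor x q.
Proof. by rewrite -pi_cat; apply/tensor_piP; exact: tensor_Dr. Qed.

Lemma pure_tensorZ x p q : p *: pure_tensor x q = pure_tensor x (p * q).
Proof. by rewrite [LHS]tensor_scaleE. Qed.

Lemma pure_tensor0 x : pure_tensor x 0 = 0.
Proof. by rewrite -[X in pure_tensor _ X](mul0r 0) -pure_tensorZ scale0r. Qed.

Lemma pure_tensorMz x (m : int) q :
  pure_tensor (x *~ m) q = pure_tensor x (m%:~R * q).
Proof.
have E0 : pure_tensor 0 q = 0.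
  by apply: (@addrI _ (pure_tensor 0 q)); rewrite -pure_tensorDl !addr0.
have En n : pure_tensor (x *+ n) q = pure_tensor x (n%:R * q).
  elim: n => [|n IHn]; first by rewrite mulr0n mul0r pure_tensor0.
  by rewrite mulrSr pure_tensorDl IHn -pure_tensorDr -[n.+1%:R]natr1 mulrDl mul1r.
case: m => n; first by rewrite -pmulrn En.
rewrite NegzE !mulrNz -!pmulrn mulNr.
apply: (@addrI _ (pure_tensor (x *+ n.+1) q)).
by rewrite -pure_tensorDl subrr E0 En -pure_tensorDr subrr pure_tensor0.
Qed.

(** There is [x0] of which every element is a rational multiple up to torsion:
    any element of infinite order if there is one, and 0 otherwise.  Then every
    tensor is [x0 (x) q] for some rational [q]. *)
Lemma dim_le1_of_dependent :
  (forall x y, exists m n : int, [/\ (m != 0) || (n != 0) & x *~ m = y *~ n]) ->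
  ~ dim_gt T 1.
Proof.
move=> dep.
have [x0 x0P] : exists x0, forall x, exists m n : int, m != 0 /\ x *~ m = x0 *~ n.
  have [[x0 x0P]|no] :=
      pselect (exists x0 : M, forall n : int, x0 *~ n = 0 -> n = 0).
    exists x0 => x; have [m [n [mn E]]] := dep x x0; exists m, n; split=> //.
    apply/eqP => m0; move: mn; rewrite m0 eqxx /= => /eqP; apply.
    by apply: x0P; rewrite -E m0 mulr0z.
  exists 0 => x; apply: contrapT => nox; apply: no; exists x => n xn.
  have [//|n0] := eqVneq n 0.
    by case: nox; exists n, 0; rewrite mulr0z.
have pure t : exists q, t = pure_tensor x0 q.
  elim/quotW: t => s; elim: s => [|[x q] s [r IHs]].
    by exists 0; rewrite pure_tensor0.
  have [m [n [m0 E]]] := x0P x; exists (n%:~R * (q / m%:~R) + r).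
  rewrite -cat1s pi_cat IHs pure_tensorDr; congr (_ + _).
  rewrite -pure_tensorMz -E pure_tensorMz mulrCA divff ?mulr1 //.
  by rewrite intr_eq0.
move=> [v vfree].
have [q0 v0] := pure (v ord0); have [q1 v1] := pure (v ord_max).
have [q00|/eqP q00] := eqVneq q0 0.
  pose c (i : 'I_2) : rat := (i == ord0)%:R.
  suff /vfree/(_ ord0)/eqP : \sum_i c i *: v i = 0.
    by rewrite /c eqxx oner_eq0.
  rewrite big_ord_recl big_ord1 /= v0 q00 pure_tensor0 scaler0.
  by rewrite scale0r addr0.
case: q00; apply: oppr_inj; rewrite oppr0.
apply: (vfree (fun i => if i == ord0 then q1 else - q0) _ ord_max).
rewrite big_ord_recl big_ord1 /= v0.
rewrite (_ : lift ord0 ord0 = ord_max); last exact: val_inj.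
by rewrite v1 !pure_tensorZ -pure_tensorDr mulNr mulrC subrr pure_tensor0.
Qed.

End TensorRank.

(** [slope_of] is a relation because germs in the line are quotients of germs
    in the interval: the identity may have several slopes, but 0 is a slope of
    the identity only. *)
Section SlopeRelation.
Context {A : groupType}.
Variable slope_of : A -> int -> Prop.
Implicit Types (u v : A) (k l : int).
Local Open Scope group_scope.
Hypothesis slope_ex : forall u, exists k, slope_of u k.
Hypothesis slopeM : forall u v k l,
  slope_of u k -> slope_of v l -> slope_of (u * v) (k + l)%R.
Hypothesis slopeV : forall u k, slope_of u k -> slope_of u^-1 (- k)%R.
Hypothesis slope0 : forall u, slope_of u 0%R -> u = 1.

Lemma slope_abelian : abelian_group A.
Proof.
move=> u v; have [k uk] := slope_ex u; have [l vl] := slope_ex v.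
apply/commgP/eqP/slope0; rewrite commgEl conjgE.
have := slopeM (slopeV uk) (slopeM (slopeV vl) (slopeM uk vl)).
by rewrite (addrCA (- l)%R) addNr addr0 addNr.
Qed.

(** If [k] and [l] are slopes of [x] and [y], then [l x - k y] has slope 0. *)
Lemma slope_rank_le1 (abA : abelian_group A) : ~ rank_gt abA 1.
Proof.
apply: dim_le1_of_dependent; pose M := additive_group abA.
have slope1 : slope_of 1 0%R.
  have [k uk] := slope_ex 1; have := slopeM uk (slopeV uk).
  by rewrite mulgV subrr.
have slopeMn (x : M) k n : slope_of x k -> slope_of (x *+ n)%R (k *+ n)%R.
  move=> xk; elim: n => [|n IHn]; first exact: slope1.
  by rewrite !mulrS; exact: slopeM.
have slopeMz (x : M) k (m : int) : slope_of x k -> slope_of (x *~ m)%R (k * m)%R.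
  move=> xk; case: m => n; first by rewrite -pmulrn -[Posz n]natz mulr_natr;
    exact: slopeMn.
  by rewrite NegzE mulrNz mulrN -pmulrn -[Posz n.+1]natz mulr_natr;
    apply/slopeV/slopeMn.
move=> x y; have [k xk] := slope_ex x; have [l yl] := slope_ex y.
have [/andP[/eqP k0 /eqP l0]|kl] := boolP ((k == 0) && (l == 0))%R.
  exists 1%R, 0%R; split=> //; rewrite mulr0z mulr1z.
  by apply: slope0; rewrite -k0.
exists l, k; split; first by rewrite -negb_and andbC.
apply: (@addIr _ (- (y *~ k))%R); rewrite subrr.
apply: slope0; have := slopeM (slopeMz x k l xk) (slopeV (slopeMz y l k yl)).
by rewrite (mulrC k) subrr.
Qed.

End SlopeRelation.

(** * Limits of the equivariant map at a place *)
Section GermLimits.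
Local Open Scope ring_scope.
Context {R : realType}.
Local Notation I := (unit_interval R).

Section Limit.
Context {Gt : groupType}.
Variables (a : {multiplicative Gt -> homeo R}) (b : {multiplicative Gt -> homeo I}).
Variable s : R -> I.
Hypotheses (s_inj : injective s) (sJ : forall g x, s (a g x) = b g (s x)).

(** [p] is the supremum ([left] is true) or the infimum of the values of [s]
    on [T].  An element that is the identity next to [p] fixes the values of
    [s] close to [p], hence their preimages, as [s] is injective. *)
Lemma limit_germ (left : bool) (T : R -> Prop) (D : Gt -> Prop) x0 :
  T x0 -> subgroup_pred D -> stable_under a D T ->
  exists p, (forall g, D g -> b g p = p) /\
    forall g, D g -> germ_slope left p (b g) 0 ->
      exists2 x, T x & forall z, T z ->
        (if left then s x <= s z else s z <= s x) -> a g z = z.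
Proof.
move=> Tx0 Dgrp DT; pose S y := exists2 x, T x & y = s x.
have S0 : S (s x0) by exists x0.
have DS : stable_under b D S.
  by move=> g _ Dg [x Tx ->]; exists (a g x); [exact: DT|rewrite sJ].
case: left.
  have [p lub] := unit_least_upper S0.
  exists p; split=> [|g Dg /germ_slope0 [r r0 gr]].
    exact: least_upper_fixed Dgrp DS lub.
  have [_ [x Tx ->] xr] := least_upper_approx S0 lub r0.
  exists x => // z Tz xz; apply: s_inj; rewrite sJ; apply: gr.
  have : s z <= p by apply: lub.1; exists z.
  by move: xz; rewrite /orientation expr1 !unit_le; lra.
have [p glb] := unit_greatest_lower S0.
exists p; split=> [|g Dg /germ_slope0 [r r0 gr]].
  exact: greatest_lower_fixed Dgrp DS glb.
have [_ [x Tx ->] xr] := greatest_lower_approx S0 glb r0.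
exists x => // z Tz xz; apply: s_inj; rewrite sJ; apply: gr.
have : p <= s z by apply: glb.1; exists z.
by move: xz; rewrite /orientation expr0 !unit_le; lra.
Qed.

End Limit.

Implicit Types (e : germ_place R) (g : homeo R) (x z : R).

(** Together with the side from which the place is approached, this describes
    the points of the line on which germs at [e] are compared. *)
Definition domain_at e x : Prop :=
  match e with
  | RightOf c => c < x
  | LeftOf c => x < c
  | PlusInfinity | MinusInfinity => True
  end.

Definition from_left e : bool :=
  match e with
  | LeftOf _ | PlusInfinity => true
  | RightOf _ | MinusInfinity => false
  end.

Lemma domain_at_nonempty e : exists x, domain_at e x.
Proof.
case: e => [c|c||] /=; [exists (c + 1)|exists (c - 1)|by exists 0|by exists 0].
  by rewrite ltrDl.
by rewrite ltrBlDr ltrDl.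
Qed.

Lemma domain_at_stable e g x :
  fixes_place e g -> domain_at e x -> domain_at e (g x).
Proof.
by case: e => [c|c||] //= /eqP gc; rewrite -{2}gc (leW_mono (@homeo_mono _ _ g)).
Qed.

Lemma trivial_germ_near e g x : fixes_place e g -> domain_at e x ->
  (forall z, domain_at e z -> (if from_left e then x <= z else z <= x) ->
    g z = z) -> trivial_germ e g.
Proof.
case: e => [c|c||] /=.
- move=> /eqP gc cx gx; exists (x - c); first by rewrite subr_gt0.
  move=> y /andP[]; rewrite le_eqVlt => /predU1P[<- //|cy yx].
  by apply: gx => //; move: yx; rewrite addrC subrK.
- move=> /eqP gc cx gx; exists (c - x); first by rewrite subr_gt0.
  move=> y /andP[xy]; rewrite le_eqVlt => /predU1P[-> //|yc].
  by apply: gx => //; move: xy; rewrite subKr.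
- by move=> _ _ gx; exists x => y /ltW; exact: gx.
- by move=> _ _ gx; exists x => y /ltW; exact: gx.
Qed.

End GermLimits.

(** * Groups of germs *)
Section GermGroups.
Local Open Scope ring_scope.
Local Open Scope quotient_scope.
Context {R : realType} (G : groupClosed (homeo R)) (e : germ_place R).
Local Notation Q := (quotient_group (@germ_kernel R G e)).
Implicit Types g h : subgroup (stabiliser G e).

Lemma stabiliser_mem g : subgroup_val g \in G.
Proof. by have /andP[] := subgroup_valP g. Qed.

Lemma stabiliser_fixes g : fixes_place e (subgroup_val g).
Proof. by have /andP[] := subgroup_valP g. Qed.

Definition stabiliser_incl g : subgroup G := Subgroup (stabiliser_mem g).

Lemma stabiliser_inclM g h :
  stabiliser_incl (g * h)%g = (stabiliser_incl g * stabiliser_incl h)%g.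
Proof. exact: val_inj. Qed.

Lemma stabiliser_inclV g : stabiliser_incl g^-1%g = (stabiliser_incl g)^-1%g.
Proof. exact: val_inj. Qed.

Lemma germ_class_eq1 g :
  trivial_germ e (subgroup_val g) -> \pi_Q g = 1%g :> germ_group G e.
Proof.
move=> tg; apply/quotient_eqP; rewrite /same_coset divg1 inE.
exact: tg.
Qed.

Local Notation I := (unit_interval R).
Variable b : {multiplicative subgroup G -> homeo I}.
Hypothesis b_thompson : forall g : subgroup G, thompson_map (b g).

Lemma germ_group_slopes (left : bool) (p : I) :
  (forall g, b (stabiliser_incl g) p = p) ->
  (forall g, germ_slope left p (b (stabiliser_incl g)) 0 ->
    trivial_germ e (subgroup_val g)) ->
  abelian_group (germ_group G e) /\
  forall abA : abelian_group (germ_group G e), ~ rank_gt abA 1.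
Proof.
move=> fixp slope0.
pose rho (u : germ_group G e) (k : int) :=
  exists2 g, u = \pi_Q g & germ_slope left p (b (stabiliser_incl g)) k.
have rho_ex u : exists k, rho u k.
  have [k gk] := thompson_germ_slope left (b_thompson _) (fixp (repr (u : Q))).
  by exists k, (repr (u : Q)); rewrite ?reprK.
have rhoM u v k l : rho u k -> rho v l -> rho (u * v)%g (k + l).
  move=> [g -> gk] [h -> hl]; exists (g * h)%g; first exact: quotient_piM.
  by rewrite stabiliser_inclM gmulfM; exact: germ_slopeM.
have rhoV u k : rho u k -> rho u^-1%g (- k).
  move=> [g -> gk]; exists g^-1%g; first exact: quotient_piV.
  by rewrite stabiliser_inclV act_inv; exact: germ_slopeV.
have rho0 u : rho u 0 -> u = 1%g.
  by move=> [g -> /slope0]; exact: germ_class_eq1.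
split; first exact: slope_abelian rho_ex rhoM rhoV rho0.
by move=> abA; exact: slope_rank_le1 rho_ex rhoM rhoV rho0 abA.
Qed.

(** The values of [s] approach their limit from the left when [s] increases
    and [e] is approached from the left, or [s] decreases and [e] is approached
    from the right; in the other two cases from the right. *)
Lemma germ_group_rank_le1 (a : {multiplicative subgroup G -> homeo R})
    (s : R -> I) :
  (forall g : subgroup G, a g = subgroup_val g) ->
  (forall (g : subgroup G) x, s (a g x) = b g (s x)) ->
  (forall x z, x < z -> s x < s z) \/ (forall x z, x < z -> s z < s x) ->
  abelian_group (germ_group G e) /\
  forall abA : abelian_group (germ_group G e), ~ rank_gt abA 1.
Proof.
move=> aE sJ s_mono.
have s_inj : injective s.
  move=> x z sxz; have [xz|zx|//] := ltgtP x z; exfalso.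
    by case: s_mono => /(_ _ _ xz); rewrite sxz ltxx.
  by case: s_mono => /(_ _ _ zx); rewrite sxz ltxx.
pose D (g : subgroup G) := fixes_place e (subgroup_val g).
have Dgrp : subgroup_pred D.
  have P x : subgroup_pred (fun g : subgroup G => subgroup_val g x == x).
    have [P1 PM PV] := point_stabiliser_subgroup a x.
    by split=> [|g h /eqP gx /eqP hx|g /eqP gx]; apply/eqP; rewrite -aE;
      [exact: P1|apply: PM; rewrite aE|apply: PV; rewrite aE].
  by rewrite /D; case: (e) => [x|x||] //; exact: P.
have DT : stable_under a D (domain_at e).
  by move=> g x Dg; rewrite aE; exact: domain_at_stable.
have [x0 Tx0] := domain_at_nonempty e.
have [left s_left] : exists left : bool, forall x z,
    (if from_left e then x <= z else z <= x) ->
    (if left then s x <= s z else s z <= s x).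
  case: s_mono => s_mono; [exists (from_left e)|exists (~~ from_left e)] => x z.
    by case: from_left => /=; rewrite le_eqVlt => /predU1P[->//|/s_mono/ltW].
  by case: from_left => /=; rewrite le_eqVlt => /predU1P[->//|/s_mono/ltW].
have [p [fixp germ0]] := limit_germ s_inj sJ left Tx0 Dgrp DT.
apply: (@germ_group_slopes left p) => g.
  exact/fixp/stabiliser_fixes.
move=> /(germ0 (stabiliser_incl g) (stabiliser_fixes g)) [x Tx gx].
apply: (trivial_germ_near (stabiliser_fixes g) Tx) => z Tz xz.
by have := gx z Tz (s_left _ _ xz); rewrite aE.
Qed.

End GermGroups.

Theorem theorem1p6 (R : realType) (G : groupClosed (homeo R)) :
  coherent G ->
  finitely_generated (subgroup G) ->
  (exists e : germ_place R,
     ~ abelian_group (germ_group G e) \/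
     exists abG : abelian_group (germ_group G e), rank_gt abG 1) ->
  ~ embeds (subgroup G) (thompsonF R).
Proof.
move=> [dense_orbits _ [gr Ggr [gr_left gr_right]] [gl Ggl [gl_right gl_left]]] _.
move=> [e germs_large] [phi phi_inj].
pose a : {multiplicative subgroup G -> homeo R} := \val.
pose b : {multiplicative subgroup G -> homeo (unit_interval R)} := \val \o phi.
have a_inj : injective a by exact: val_inj.
have b_inj : injective b by exact: inj_comp val_inj phi_inj.
have b_thompson g : thompson_map (b g).
  by have /asboolP := subgroup_valP (phi g).
have orbit_dense x u v : (u < v)%R -> exists g, (u < a g x < v)%R.
  move=> uv; have := dense_orbits x `]u, v[%classic.
  case=> [||y [yuv [g Gg gy]]].
  - by exists ((u + v) / 2)%R => /=; rewrite in_itv /= !midf_lt.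
  - exact: interval_open.
  by exists (Subgroup Gg); move: yuv; rewrite -gy /= in_itv.
have [||s sJ s_mono] :=
    @equivariant_strictly_monotone R (subgroup G) a b a_inj b_inj orbit_dense
      _ _ b_thompson.
- by exists (Subgroup Ggr).
- by exists (Subgroup Ggl).
have [ab rank_le1] :=
  @germ_group_rank_le1 R G e b b_thompson a s (fun=> erefl) sJ s_mono.
by case: germs_large => [//|[abG]]; exact: rank_le1.
Qed.
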